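(* Let $S$ be a smooth closed strictly convex surface in $\mathbb{R}^{3}$ which is invariant under the reflection with respect to the plane $y=0$ and contains the graph of the function $\varphi:(-2,2)\times(-1,1)\to\mathbb{R}$ defined by $\varphi(x,y)=f(x)+y^{2}$, where $f$ is a smooth function satisfying $f(0)=f'(0)=f''(0)=0$. Then the outer billiard map $B$ on $\mathcal{G}_{0}$ associated with $S$ is not smooth.
   Context: $\mathcal{G}_0$ is the four-dimensional manifold of oriented straight lines of $\mathbb{R}^3$ (quotient of the unit tangent bundle $T^1\mathbb{R}^3$ by the geodesic flow). ''Smooth'' means $C^\infty$; a closed surface is a compact, connected, embedded surface without boundary. $S$ is strictly convex if for each $p\in S$ the affine plane tangent to $S$ at $p$ intersects $S$, near $p$, only at $p$. Outer billiard map. Let $\mathcal{U}$ be the set of oriented lines not intersecting $S$. For $\ell\in\mathcal{U}$, parametrized with unit speed by $\alpha$, there are exactly two planes $P_\pm$ containing $\ell$ and tangent to $S$, at points $p_\pm$. Let $q_\pm$ be the point of $\ell$ closest to $p_\pm$, $d_\pm=|p_\pm-q_\pm|$ and $W_\pm=(p_\pm-q_\pm)/d_\pm$; the signs are chosen so that $\{W_+,W_-,\alpha'\}$ is a positively oriented basis of $\mathbb{R}^3$. Then $B:\mathcal{U}\to\mathcal{U}$ sends $\ell$ to the oriented line obtained by translating $\ell$ by the vector $2d_+W_+$. *)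

(* Defs.v *)
From HB Require Import structures.
From mathcomp Require Import all_boot all_order all_algebra.
From mathcomp Require Import generic_quotient.
From mathcomp Require Import all_classical all_reals all_analysis.
Set Implicit Arguments.
Unset Strict Implicit.
Unset Printing Implicit Defensive.
Import Order.TTheory GRing.Theory Num.Theory.
Import numFieldNormedType.Exports.
Local Open Scope classical_set_scope.
Local Open Scope ring_scope.

Section EuclideanSpace.
Variable R : realType.
Implicit Types (u v w : 'rV[R]_3).

Definition vec3 (x y z : R) : 'rV[R]_3 := \row_(i < 3) [:: x; y; z]`_i.

Definition dotv u v : R := \sum_(i < 3) u 0 i * v 0 i.

(* The library norm on row vectors is the sup norm, hence this definition. *)
Definition enorm u : R := Num.sqrt (dotv u u).

Definition positively_oriented u v w : Prop :=
  0 < \det (\matrix_(i < 3) nth 0 [:: u; v; w] i).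

Definition reflect_y u : 'rV[R]_3 := vec3 (u 0 0) (- u 0 1) (u 0 2).

End EuclideanSpace.

(* C^oo on A, for A open and V finite-dimensional: all iterated directional
   derivatives, of every order, are differentiable at every point of A. *)
Definition iter_derive (R : realType) (V W : normedModType R)
    (vs : seq V) (f : V -> W) : V -> W :=
  foldr (fun v g => 'D_v g) f vs.

Definition smooth_on (R : realType) (V W : normedModType R)
    (A : set V) (f : V -> W) : Prop :=
  forall (vs : seq V) (x : V), A x -> differentiable (iter_derive vs f) x.

Section Surfaces.
Variable R : realType.
Implicit Types (S V W : set 'rV[R]_3) (p : 'rV[R]_3).

Definition diffeomorphism V W (F G : 'rV[R]_3 -> 'rV[R]_3) : Prop :=
  [/\ smooth_on V F, smooth_on W G,
      forall x, V x -> W (F x) /\ G (F x) = x &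
      forall y, W y -> V (G y) /\ F (G y) = y].

(* Embedded two-dimensional submanifold without boundary: around each of its
   points S is straightened to the plane z = 0 by an ambient diffeomorphism. *)
Definition embedded_surface S : Prop :=
  forall p, S p -> exists V W F G,
    [/\ open V, V p, open W, diffeomorphism V W F G &
        forall x, V x -> (S x <-> F x 0 2 = 0)].

Definition closed_surface S : Prop :=
  [/\ S !=set0, compact S, connected S & embedded_surface S].

Definition tangent_vector S p (v : 'rV[R]_3) : Prop :=
  exists (c : R -> 'rV[R]_3) (e : R),
    [/\ 0 < e, smooth_on (`]- e, e[%classic : set R^o) c,
        forall t, `]- e, e[%classic t -> S (c t),
        c 0 = p & c^`()%classic 0 = v].

Definition tangent_plane S p : set 'rV[R]_3 :=
  [set x | tangent_vector S p (x - p)].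

Definition strictly_convex S : Prop :=
  forall p, S p -> \forall x \near p, S x -> tangent_plane S p x -> x = p.

End Surfaces.

Section OrientedLines.
Variable R : realType.

Definition unit_tangent : Type :=
  {x : 'rV[R]_3 * 'rV[R]_3 | dotv x.2 x.2 == 1}.
HB.instance Definition _ := Choice.on unit_tangent.

Definition ut_point (x : unit_tangent) : 'rV[R]_3 := (val x).1.
Definition ut_dir (x : unit_tangent) : 'rV[R]_3 := (val x).2.

Definition ut_translate (w : 'rV[R]_3) (x : unit_tangent) : unit_tangent :=
  exist _ (ut_point x + w, ut_dir x) (valP x).

Definition geodesic_flow (t : R) (x : unit_tangent) : unit_tangent :=
  ut_translate (t *: ut_dir x) x.

Definition same_orbit (x y : unit_tangent) : bool :=
  `[< exists t, y = geodesic_flow t x >].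

Lemma geodesic_flow0 x : geodesic_flow 0 x = x.
Proof.
by apply/val_inj; rewrite /= scale0r addr0 /ut_point /ut_dir -surjective_pairing.
Qed.

Lemma geodesic_flowD s t x :
  geodesic_flow s (geodesic_flow t x) = geodesic_flow (t + s) x.
Proof. by apply/val_inj; rewrite /= /ut_point /ut_dir /= scalerDl addrA. Qed.

Lemma same_orbit_equiv : equiv_class_of same_orbit.
Proof.
split.
- by move=> x; apply/asboolP; exists 0; rewrite geodesic_flow0.
- have sym x y : same_orbit x y -> same_orbit y x.
    move=> /asboolP[t ->]; apply/asboolP; exists (- t).
    by rewrite geodesic_flowD subrr geodesic_flow0.
  by move=> x y; apply/idP/idP; apply: sym.
- move=> y x z /asboolP[s ->] /asboolP[t ->]; apply/asboolP.
  by exists (s + t); rewrite geodesic_flowD.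
Qed.

Canonical same_orbit_equiv_rel := EquivRelPack same_orbit_equiv.

(* G_0. *)
Definition oriented_line : Type := {eq_quot same_orbit}%qT.

Implicit Types L : oriented_line.

Definition line_of (x : unit_tangent) : oriented_line :=
  (\pi_oriented_line x)%qT.

(* A chosen point of L and the (well-defined) unit direction of L. *)
Definition line_point L : 'rV[R]_3 := ut_point (repr L).
Definition line_dir L : 'rV[R]_3 := ut_dir (repr L).

Definition line_set L : set 'rV[R]_3 :=
  [set line_point L + t *: line_dir L | t in setT].

Definition line_translate (w : 'rV[R]_3) L : oriented_line :=
  line_of (ut_translate w (repr L)).

(* Atlas of G_0 by six charts onto R^2 x R^2, indexed by a coordinate axis i and
   a sign s. The domain of chart (i, s) consists of the lines whose direction v
   has v_i of sign (-1)^s; the coordinates of a line are its intersection with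
   the plane x_i = 0 and its slope v / v_i, both without the i-th entry. *)
Definition chart_dom (i : 'I_3) (s : bool) : set oriented_line :=
  [set L | 0 < (-1) ^+ s * line_dir L 0 i].

Definition chart_coord (i : 'I_3) L : 'rV[R]_2 * 'rV[R]_2 :=
  let a := line_point L in let v := line_dir L in
  (col' i (a - (a 0 i / v 0 i) *: v), col' i ((v 0 i)^-1 *: v)).

(* Smoothness on the open set U of a map of G_0 to itself: around each line of
   U, g is the expression of F in charts (i, s) and (j, t). *)
Definition smooth_line_map_on (U : set oriented_line)
    (F : oriented_line -> oriented_line) : Prop :=
  forall L, U L -> exists (i j : 'I_3) (s t : bool)
      (O : set ('rV[R]_2 * 'rV[R]_2))
      (g : 'rV[R]_2 * 'rV[R]_2 -> 'rV[R]_2 * 'rV[R]_2),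
    [/\ chart_dom i s L, open O, O (chart_coord i L), smooth_on O g &
        forall L', chart_dom i s L' -> O (chart_coord i L') ->
          [/\ U L', chart_dom j t (F L') &
              chart_coord j (F L') = g (chart_coord i L')]].

End OrientedLines.

Section OuterBilliard.
Variable R : realType.
Implicit Types (S : set 'rV[R]_3) (L : oriented_line R).

Definition lines_avoiding S : set (oriented_line R) :=
  [set L | line_set L `&` S = set0].

Definition closest_point (A : set 'rV[R]_3) (p q : 'rV[R]_3) : Prop :=
  A q /\ forall q', A q' -> enorm (p - q) <= enorm (p - q').

(* P = p + T_pS is one of the planes through L tangent to S, at p; q is the
   point of L closest to p. *)
Definition tangency S L (p q : 'rV[R]_3) : Prop :=
  [/\ S p, line_set L `<=` tangent_plane S p & closest_point (line_set L) p q].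

Definition outer_billiard_rel S L L' : Prop :=
  exists pp qp pm qm : 'rV[R]_3,
    let dp := enorm (pp - qp) in let Wp := dp^-1 *: (pp - qp) in
    let dm := enorm (pm - qm) in let Wm := dm^-1 *: (pm - qm) in
    [/\ tangency S L pp qp, tangency S L pm qm,
        positively_oriented Wp Wm (line_dir L) &
        L' = line_translate ((2 * dp) *: Wp) L].

(* The map B; only its values on lines_avoiding S are meaningful, where L' is
   uniquely determined (elsewhere xget may fall back on the identity). *)
Definition outer_billiard S L : oriented_line R :=
  xget L [set L' | outer_billiard_rel S L L'].

End OuterBilliard.

(* Main.v *)
(* Lines parallel to the y-axis through points of the plane y = 0 are permuted by
   B: by the reflection symmetry their tangency points lie in that plane, and for
   x in (-2, 2) and t > 0 the line through (x + t, 0, f x + t f' x) is mapped to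
   the one through (x - t, 0, f x - t f' x). At x = 0 the derivatives with respect
   to x and to t of the former point coincide, because f' and f'' vanish there,
   while those of the latter are opposite; so B is not differentiable there.
   Evaluating B needs that S lies strictly on one side of each of its tangent
   planes. Strict convexity being a local hypothesis, every critical point of a
   linear function h on S is a strict local extremum, and a minimax argument on
   the components of the sublevel sets of h shows that a strict local minimum of h
   is its only global minimum. *)
From HB Require Import structures.
Require Import Defs.
From mathcomp Require Import all_boot all_order all_algebra generic_quotient.
From mathcomp Require Import all_classical all_reals all_analysis.
From mathcomp Require Import ring lra.
Import Order.TTheory GRing.Theory Num.Theory.
Import numFieldNormedType.Exports.
Local Open Scope classical_set_scope.
Local Open Scope ring_scope.

(** * Strict local minima on compact connected sets *)

(** The minimax argument works because no saddle exists. If [x] were another point at most as high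
    as a strict local minimum [p], then, [S] being connected, raising the level would at some moment
    merge the parts of the sublevel set around [p] and around [x], at a point of the critical level.
    A strict local minimum only adds an isolated point; at a noncritical point the strict sublevel
    set is locally one piece; at a strict local maximum it is a punctured disk, which is connected
    because [S] has dimension two. So nothing can merge. A second obstacle is that
    [outer_billiard_rel] asks for both tangencies. The graph provides only one of them; the other is
    found by a minimization over [S]. The term [y^2] decides on which side of its tangent planes [S]
    lies, hence that the tangency on the graph is the positive one. *)

Definition strict_local_min {R : realType} {T : topologicalType}
    (S : set T) (h : T -> R) (y : T) : Prop :=
  \forall z \near y, S z -> h z <= h y -> z = y.

(** Prevents two parts of the strict sublevel set from meeting for the first time at [y]. The purely
    topological form covers noncritical points and strict local maxima at once. *)
Definition regular_sublevel {R : realType} {T : topologicalType}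
    (S : set T) (h : T -> R) (y : T) : Prop :=
  exists N, [/\ nbhs y N, connected (N `&` S `&` [set z | h z < h y]) &
    N `&` S `&` [set z | h z <= h y] `<=`
      closure (N `&` S `&` [set z | h z < h y])].

Definition locally_connected_in {T : topologicalType} (S : set T) (y : T) :
    Prop :=
  forall O, nbhs y O ->
    exists N, [/\ nbhs y N, N `<=` O & connected (N `&` S)].

(** Closed covers replace connected components here: disjoint closed sets can be thickened to
    disjoint open ones, which allows the level to be raised. *)
Definition sublevel_separates {R : realType} {T : topologicalType}
    (S : set T) (h : T -> R) (p x : T) (c : R) : Prop :=
  exists A B, [/\ closed A, closed B, A `&` B = set0, A p /\ B x &
    S `&` [set z | h z <= c] `<=` A `|` B].

Lemma closed_separated {T : topologicalType} (A B : set T) :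
  closed A -> closed B -> A `&` B = set0 -> separated A B.
Proof.
move=> /closure_id cA /closure_id cB AB; split; first by rewrite -cA.
by rewrite -cB.
Qed.

Lemma connected_sublevel_separates {R : realType} {T : topologicalType}
    (S : set T) (h : T -> R) (p x : T) (c : R) (K : set T) :
  sublevel_separates S h p x c -> connected K ->
  K `<=` S `&` [set z | h z <= c] -> K p -> K x -> False.
Proof.
move=> [A [B [cA cB AB [Ap Bx] SAB]]] cK KS Kp Kx.
have AB0 z : A z -> B z -> False.
  by move=> Az Bz; have : (A `&` B) z by []; rewrite AB.
have [KA|KB] := connected_subset (closed_separated _ _ cA cB AB)
  (subset_trans KS SAB) cK.
- exact: (AB0 x (KA _ Kx) Bx).
- exact: (AB0 p Ap (KB _ Kp)).
Qed.

(** Thicken the two closed pieces to disjoint open sets [U] and [V]. On the compact rest of [S] the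
    function exceeds [c], hence so does its minimum there, and a level in between still avoids that
    rest. *)
Lemma sublevel_separates_lt {R : realType} {T : pseudoMetricType R}
    (S : set T) (h : T -> R) (p x : T) (c : R) :
  hausdorff_space T -> compact S -> continuous h ->
  S p -> S x -> h p <= c -> h x <= c ->
  sublevel_separates S h p x c ->
  exists2 c', c < c' & sublevel_separates S h p x c'.
Proof.
move=> hT kS ch Sp Sx hp hx [A [B [cA cB AB [Ap Bx] SAB]]].
have [U [V [oU oV AU BV UV]]] :=
  (@normal_openP R T).1 pseudometric_normal A B cA cB AB.
have UV0 z : U z -> V z -> False.
  by move=> Uz Vz; have : (U `&` V) z by []; rewrite UV.
have clS := compact_closed hT kS.
pose K := S `&` ~` (U `|` V).
have kK : compact K.
  apply: (subclosed_compact _ kS); last by move=> z [].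
  by apply: closedI => //; apply: open_closedC; exact: openU.
have [c' cc' Kc'] : exists2 c', c < c' & forall z, K z -> c' < h z.
  have [K0|K0] := eqVneq K set0.
    by exists (c + 1); [rewrite ltrDl|rewrite K0].
  move/set0P in K0.
  have [z /set_mem Kz zmin] := compact_EVT_min K0 kK (continuous_subspaceT ch).
  have cz : c < h z.
    rewrite ltNge; apply/negP => hz; case: Kz => Sz; apply.
    by case: (SAB z) => // [/AU|/BV]; [left|right].
  exists ((c + h z) / 2); first by rewrite midf_lt.
  by move=> w Kw; apply: lt_le_trans (zmin w (mem_set Kw)); rewrite midf_lt.
have clh : closed (S `&` [set z | h z <= c']).
  by apply: closedI => //; apply: (closed_comp _ (@closed_le _ c')) => z _; exact: ch.
exists c' => //.
exists (S `&` [set z | h z <= c'] `&` ~` V),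
  (S `&` [set z | h z <= c'] `&` ~` U); split.
- by apply: closedI => //; exact: open_closedC.
- by apply: closedI => //; exact: open_closedC.
- rewrite -subset0 => z [[[Sz hz] nV] [_ nU]].
  have Kz : K z by split=> // -[].
  by have := Kc' z Kz; rewrite ltNge hz.
- split; split; try by split => //=; apply: ltW; apply: le_lt_trans cc'.
  + by move=> Vp; exact: (UV0 p (AU _ Ap) Vp).
  + by move=> Ux; exact: (UV0 x Ux (BV _ Bx)).
- move=> z [Sz hz]; have [Vz|nV] := pselect (V z).
    by right; split=> // Uz; exact: (UV0 z).
  by left.
Qed.

(** Strictness isolates [p] in the sublevel set of its own level. *)
Lemma sublevel_separates_min {R : realType} {T : pseudoMetricType R}
    (S : set T) (h : T -> R) (p x : T) :
  hausdorff_space T -> compact S -> continuous h ->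
  strict_local_min S h p -> S x -> h x <= h p -> x <> p ->
  sublevel_separates S h p x (h p).
Proof.
move=> hT kS ch /nbhs_interior minp Sx hx xp.
set N := (X in nbhs p (interior X)) in minp.
have Np : (interior N) p by exact: nbhs_singleton.
exists [set p], (S `&` [set z | h z <= h p] `&` ~` (interior N)); split.
- exact: accessible_closed_set1 (hausdorff_accessible hT) _.
- apply: closedI; last by apply: open_closedC; exact: open_interior.
  apply: closedI; first exact: compact_closed.
  by apply: (closed_comp _ (@closed_le _ (h p))) => z _; exact: ch.
- by rewrite -subset0 => z [-> [_]].
- split=> //; split=> // /interior_subset Nx; exact: xp (Nx _ _).
- move=> z [Sz hz]; have [Nz|nN] := pselect ((interior N) z); last by right.
  by left; move/interior_subset : Nz => /(_ Sz hz).
Qed.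

(** [A] gathers what is joined to [p] by connected sets below levels less than [c]. Its closure is
    one piece and the rest of the sublevel set the other. The rest could fail to be closed only
    where two parts of [{h < c}] touch at level [c], which the local alternative excludes. *)
Lemma sublevel_separates_sup {R : realType} {T : pseudoMetricType R}
    (S : set T) (h : T -> R) (p x : T) (c : R) :
  hausdorff_space T -> compact S -> continuous h ->
  (forall y, S y -> locally_connected_in S y) ->
  (forall y, S y -> strict_local_min S h y \/ regular_sublevel S h y) ->
  S p -> S x -> h p < c -> h x < c ->
  (forall c', c' < c -> sublevel_separates S h p x c') ->
  sublevel_separates S h p x c.
Proof.
move=> hT kS ch lcS lmS Sp Sx hp hx sepS.
have clS := compact_closed hT kS.
pose A := [set y | exists c' K, [/\ c' < c, connected K,
  K `<=` S `&` [set z | h z <= c'], K p & K y]].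
have AS y : A y -> S y /\ h y < c.
  move=> [c' [K [c'c _ KS _ Ky]]]; have [Sy hy] := KS _ Ky.
  by split=> //; exact: le_lt_trans hy c'c.
have Ap : A p.
  exists (h p), [set p]; split=> //; try exact: connected1.
  by move=> z ->; split=> /=.
have nAx : ~ A x.
  by move=> [c' [K [/sepS s cK KS Kp Kx]]];
     exact: (connected_sublevel_separates _ _ _ _ _ _ s cK KS Kp Kx).
(* Below level [c], both [A] and its complement are open in [S]: a small connected neighbourhood
   that meets [A] can be glued to a connected set from [p], and the level [Num.max d c'] of the
   union is still less than [c]. *)
have locA y : S y -> h y < c ->
    exists2 N, nbhs y N & forall z, N z -> A z -> N `&` S `<=` A.
  move=> Sy hy; pose d := (h y + c) / 2.
  have hd : h y < d by rewrite midf_lt.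
  have dc : d < c by rewrite midf_lt.
  have Od : nbhs y [set z | h z < d].
    apply: (ch y [set r | r < d]); apply: open_nbhs_nbhs.
    by split=> //; exact: open_lt.
  have [N [yN NO cN]] := lcS y Sy _ Od.
  exists N => // z Nz [c' [K [c'c cK KS Kp Kz]]] w NSw.
  exists (Num.max d c'), (K `|` (N `&` S)); split.
  - by rewrite gt_max dc c'c.
  - apply: connectedU => //; exists z; split=> //; split=> //.
    by case: (KS _ Kz).
  - move=> u [/KS[Su /= hu]|[/NO/= /ltW hu Su]]; split=> //=.
      by rewrite le_max hu orbT.
    by rewrite le_max hu.
  - by left.
  - by right.
(* The closure of [A] is open in the sublevel set. At level [c], a strict local minimum is no limit
   of the strictly lower points of [A]; at a regular point the connected local part of [{h < c}]
   meets [A], so it lies in [A], and its closure fills the neighbourhood. *)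
have locC y : S y -> h y <= c -> closure A y ->
    exists2 N, nbhs y N & N `&` S `&` [set z | h z <= c] `<=` closure A.
  move=> Sy; rewrite le_eqVlt => /predU1P[hyc|hy] Ay; last first.
    have [N yN NA] := locA y Sy hy; exists N => // z [NSz _].
    have [w [Aw Nw]] := Ay N yN.
    by apply: subset_closure; exact: (NA w).
  have [miny|[N [yN cN NC]]] := lmS y Sy.
    have [w [Aw /=]] := Ay _ miny; have [Sw hw] := AS w Aw.
    by rewrite hyc => /(_ Sw (ltW hw)) wy; move: hw; rewrite wy hyc ltxx.
  exists N => //; rewrite hyc in cN NC.
  set K := _ `&` [set z | h z < c] in cN NC.
  apply: subset_trans NC _; apply: closureS.
  have [w [Aw Nw]] := Ay N yN; have [Sw hw] := AS w Aw.
  have sepK : separated (K `&` A) (K `\` A).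
    split; rewrite -subset0 => z.
      move=> [cz [[[Nz Sz] hz] nAz]]; have [M zM MA] := locA z Sz hz.
      have [u [[_ Au] Mu]] := cz M zM.
      by apply: nAz; apply: (MA u) => //; split=> //; exact: nbhs_singleton.
    move=> [[[[Nz Sz] hz] Az] cz]; have [M zM MA] := locA z Sz hz.
    have [u [[[[_ Su] _] nAu] Mu]] := cz M zM.
    by apply: nAu; apply: (MA z) => //; exact: nbhs_singleton.
  have KU : K `<=` (K `&` A) `|` (K `\` A).
    by move=> z Kz; have [Az|nAz] := pselect (A z); [left|right].
  have Kw : K w by [].
  have [KA|KA] := connected_subset sepK KU cN.
    by move=> z /KA[].
  by case: (KA w Kw).
have cAS y : closure A y -> S y /\ h y <= c.
  have cl : closed (S `&` [set z | h z <= c]).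
    apply: closedI => //.
    by apply: (closed_comp _ (@closed_le _ c)) => z _; exact: ch.
  by move=> Ay; apply: cl; apply: closureS Ay => u /AS[Su /ltW].
exists (closure A), (S `&` [set z | h z <= c] `&` ~` closure A); split.
- exact: closed_closure.
- move=> z Bz.
  have cl : closed (S `&` [set z | h z <= c]).
    apply: closedI => //.
    by apply: (closed_comp _ (@closed_le _ c)) => u _; exact: ch.
  have [Sz hz] : (S `&` [set z | h z <= c]) z.
    by apply: cl; apply: closureS Bz => u [].
  split=> // cAz; have [N zN NA] := locC z Sz hz cAz.
  have [u [[[Su hu] nAu] Nu]] := Bz N zN.
  by apply: nAu; apply: NA.
- by rewrite -subset0 => z [? []].
- split; first exact: subset_closure.
  split; first by split=> //; exact: ltW.
  move=> cAx; have [N xN NA] := locA x Sx hx.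
  have [u [Au Nu]] := cAx N xN.
  by apply: nAx; apply: (NA u) => //; split=> //; exact: nbhs_singleton.
- move=> z Sz; have [cAz|ncAz] := pselect (closure A z); first by left.
  by right.
Qed.

(** The separating levels contain [h p], are bounded by the maximum of [h] because [S] is connected,
    and contain their supremum; yet separation always persists slightly higher. *)
Lemma strict_local_min_global {R : realType} {T : pseudoMetricType R}
    (S : set T) (h : T -> R) (p : T) :
  hausdorff_space T -> compact S -> connected S -> continuous h ->
  (forall y, S y -> locally_connected_in S y) ->
  (forall y, S y -> strict_local_min S h y \/ regular_sublevel S h y) ->
  S p -> strict_local_min S h p ->
  forall x, S x -> x <> p -> h p < h x.
Proof.
move=> hT kS cS ch lcS lmS Sp minp x Sx xp.
rewrite ltNge; apply/negP => hx.
pose E := [set c | h p <= c /\ sublevel_separates S h p x c].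
have Ep : E (h p) by split=> //; exact: sublevel_separates_min.
have [m /set_mem Sm mmax] :=
  compact_EVT_max (ex_intro _ p Sp) kS (continuous_subspaceT ch).
have Eub c : E c -> c <= h m.
  move=> [_ sep]; rewrite leNgt; apply/negP => mc.
  apply: (connected_sublevel_separates _ _ _ _ _ _ sep cS _ Sp Sx) => z Sz.
  by split=> //=; apply: le_trans (mmax z (mem_set Sz)) (ltW mc).
have supE : has_sup E by split; [exists (h p)|exists (h m)].
have pc : h p <= sup E by exact: sup_upper_bound.
have sepc : sublevel_separates S h p x (sup E).
  move: pc; rewrite le_eqVlt => /predU1P[<-|pc]; first by case: Ep.
  apply: sublevel_separates_sup => //; first exact: le_lt_trans pc.
  move=> c' cc'; have c'0 : 0 < sup E - c' by rewrite subr_gt0.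
  have [e [_ [A [B [cA cB AB pAB SAB]]]] c'e] := sup_adherent c'0 supE.
  exists A, B; split=> //; apply: subset_trans SAB => z [Sz /= hz]; split=> //=.
  by apply: le_trans hz _; move: c'e; rewrite opprB addrC subrK => /ltW.
have [|c' cc' sep'] :=
  sublevel_separates_lt S h p x _ hT kS ch Sp Sx pc _ sepc.
  exact: le_trans pc.
have : c' <= sup E.
  by apply: sup_upper_bound => //; split=> //; apply: le_trans pc (ltW cc').
by rewrite leNgt cc'.
Qed.

(** * Linear forms and derivatives along lines *)

Lemma dotvE {R : realType} (u v : 'rV[R]_3) :
  dotv u v = u 0 0 * v 0 0 + u 0 1 * v 0 1 + u 0 2 * v 0 2.
Proof.
rewrite /dotv !big_ord_recr big_ord0 /= add0r.
by congr (_ * _ + _ * _ + _ * _); congr (_ _ _); apply/val_inj.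
Qed.

Lemma ord3P (i : 'I_3) : [\/ i = 0, i = 1 | i = 2].
Proof.
case: i => -[|[|[|//]]] lti; [constructor 1|constructor 2|constructor 3];
  exact/val_inj.
Qed.

Lemma rv3P {R : realType} (u v : 'rV[R]_3) :
  u 0 0 = v 0 0 -> u 0 1 = v 0 1 -> u 0 2 = v 0 2 -> u = v.
Proof. by move=> ? ? ?; apply/rowP => i; case: (ord3P i) => ->. Qed.

Lemma vec3E {R : realType} (x y z : R) :
  ((vec3 x y z 0 0 = x) * (vec3 x y z 0 1 = y) * (vec3 x y z 0 2 = z))%type.
Proof. by rewrite !mxE. Qed.

Lemma dotv_is_linear {R : realType} (n : 'rV[R]_3) :
  linear (dotv n : 'rV[R]_3 -> R^o).
Proof.
by move=> a u v; rewrite !dotvE !mxE /GRing.scale /=; ring.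
Qed.

HB.instance Definition _ (R : realType) (n : 'rV[R]_3) :=
  GRing.isLinear.Build R 'rV[R]_3 R^o _ (dotv n : 'rV[R]_3 -> R^o) (dotv_is_linear n).

Lemma dotvC {R : realType} (u v : 'rV[R]_3) : dotv u v = dotv v u.
Proof. by rewrite !dotvE; ring. Qed.

Lemma dotv_gt0 {R : realType} (u : 'rV[R]_3) : u != 0 -> 0 < dotv u u.
Proof.
move=> u0; rewrite lt_neqAle; apply/andP; split; last first.
  by rewrite dotvE -!expr2 !addr_ge0 ?sqr_ge0.
apply: contraNneq u0; rewrite dotvE -!expr2 => /esym/eqP.
rewrite paddr_eq0 ?addr_ge0 ?sqr_ge0// paddr_eq0 ?sqr_ge0// !sqrf_eq0.
by move=> /andP[/andP[/eqP u0 /eqP u1] /eqP u2]; apply/eqP/rv3P; rewrite ?u0 ?u1 ?u2 mxE.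
Qed.

Lemma continuous_dotv {R : realType} (n : 'rV[R]_3) : continuous (dotv n : _ -> R^o).
Proof.
move=> x; apply: differentiable_continuous.
rewrite (_ : dotv n = n 0 0 *: (fun v : 'rV[R]_3 => v 0 0 : R^o) +
    n 0 1 *: (fun v : 'rV[R]_3 => v 0 1 : R^o) +
    n 0 2 *: (fun v : 'rV[R]_3 => v 0 2 : R^o)); last first.
  by apply/funext => v; rewrite dotvE.
by do 2?apply: differentiableD; apply: differentiableZ;
  exact: differentiable_coord.
Qed.

Lemma is_diff_dotv {R : realType} (n x : 'rV[R]_3) :
  is_diff x (dotv n : _ -> R^o) (dotv n).
Proof.
apply: DiffDef; first exact: linear_differentiable (continuous_dotv n).
by rewrite diff_lin //; exact: continuous_dotv.
Qed.

Lemma coordE {R : realType} (i : 'I_3) :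
  (fun v : 'rV[R]_3 => v 0 i) = dotv (delta_mx 0 i).
Proof.
apply/funext => v; rewrite dotvE !mxE.
by case: (ord3P i) => ->; rewrite /=; ring.
Qed.

Lemma is_diff_line {R : realType} {V W : normedModType R} (G : V -> W) (a w : V) (t : R) :
  differentiable G (a + t *: w) ->
  is_diff t (fun s : R => G (a + s *: w)) (fun h => h *: 'd G (a + t *: w) w).
Proof.
move=> dG.
have dl : is_diff t (fun s : R => a + s *: w) ( *:%R^~ w).
  have -> : (fun s : R => a + s *: w) = cst a + *:%R^~ w by [].
  by apply: is_diff_eq; rewrite add0r.
have dG' : is_diff (a + t *: w) G ('d G (a + t *: w)) by exact: differentiableP.
apply: (is_diff_eq (is_diff_comp dl dG')).
by apply/funext => h /=; rewrite linearZ.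
Qed.

Lemma near_line {R : realType} {V : normedModType R} (A : set V) (a w : V) (t : R) :
  open A -> A (a + t *: w) -> \forall s \near t, A (a + s *: w).
Proof.
move=> oA Aat.
have c : {for t, continuous (fun s : R => a + s *: w)}.
  apply: differentiable_continuous.
  by have [] := is_diff_line id a w t _.
by apply: (c A); exact: open_nbhs_nbhs.
Qed.

(** Directions on the line are scalars and derivatives are linear in the direction, so [c] is the
    product of the entries of [vs]. *)
Lemma iter_derive_line {R : realType} {V W : normedModType R} (A : set V) (G : V -> W)
    (a w : V) (vs : seq R^o) :
  open A -> smooth_on A G -> exists c : R, forall t : R, A (a + t *: w) ->
  iter_derive vs ((fun s : R => G (a + s *: w)) : R^o -> W) t =
  c *: iter_derive (nseq (size vs) w) G (a + t *: w).
Proof.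
move=> oA sG; elim: vs => [|v vs [c IH]].
  by exists 1 => t _; rewrite scale1r.
exists (c * v) => t At /=.
set H := iter_derive _ G in IH *.
have dH : differentiable H (a + t *: w) by exact: sG.
have [dl vl] := is_diff_line H a w t dH.
have -> : 'D_v (iter_derive vs ((fun s : R => G (a + s *: w)) : R^o -> W)) t =
    'D_v (c *: (fun s : R => H (a + s *: w)) : R^o -> W) t.
  apply: near_eq_derive; near=> s; apply: IH.
  by near: s; exact: near_line.
rewrite deriveE; last exact: differentiableZ.
by rewrite diffZ // vl /= -deriveE // scalerA.
Unshelve. all: by end_near. Qed.

Lemma smooth_on_line {R : realType} {V W : normedModType R} (A : set V) (G : V -> W)
    (a w : V) (I : set R^o) :
  open A -> smooth_on A G -> (forall t : R, I t -> A (a + t *: w)) ->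
  smooth_on I ((fun s : R => G (a + s *: w)) : R^o -> W).
Proof.
move=> oA sG IA vs t It; have At := IA t It.
have [c ic] := iter_derive_line A G a w vs oA sG.
set H := iter_derive (nseq (size vs) w) G in ic.
have dH : differentiable H (a + t *: w) by exact: sG.
have [dl _] := is_diff_line H a w t dH.
apply/derivable1_diffP.
apply: (@near_eq_derivable R R^o W (c *: (fun s : R => H (a + s *: w))) _ t 1); last first.
  by apply/derivable1_diffP; exact: differentiableZ.
near=> s; apply/esym/ic.
by near: s; exact: near_line.
Unshelve. all: by end_near. Qed.

Lemma diffeomorphism_sym {R : realType} (V W : set 'rV[R]_3) (F G : 'rV[R]_3 -> 'rV[R]_3) :
  diffeomorphism V W F G -> diffeomorphism W V G F.
Proof. by case. Qed.

Lemma smooth_on_differentiable {R : realType} {V W : normedModType R} (A : set V)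
  (f : V -> W) x : smooth_on A f -> A x -> differentiable f x.
Proof. by move=> /(_ [::]); apply. Qed.

Lemma diffeomorphism_diffK {R : realType} (V W : set 'rV[R]_3)
    (F G : 'rV[R]_3 -> 'rV[R]_3) x v :
  open V -> diffeomorphism V W F G -> V x -> 'd G (F x) ('d F x v) = v.
Proof.
move=> oV [sF sG FK GK] Vx.
have [WFx GFx] := FK x Vx.
have dF := smooth_on_differentiable _ _ _ sF Vx.
have dG := smooth_on_differentiable _ _ _ sG WFx.
have <- : 'd (G \o F) x v = 'd G (F x) ('d F x v).
  by have := diff_comp dF dG => /(congr1 (fun k => k v)).
rewrite -deriveE; last exact: differentiable_comp.
rewrite -[RHS](derive_id x); apply: near_eq_derive.
near=> y; have Vy : V y by near: y; exact: open_nbhs_nbhs.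
by case: (FK y Vy).
Unshelve. all: by end_near. Qed.

(** * Tangent vectors in charts *)

Definition surface_chart {R : realType} (S : set 'rV[R]_3) (y : 'rV[R]_3)
    (V W : set 'rV[R]_3) (F G : 'rV[R]_3 -> 'rV[R]_3) : Prop :=
  [/\ S y, open V /\ V y, open W, diffeomorphism V W F G &
      forall x, V x -> (S x <-> F x 0 2 = 0)].

(** The third chart coordinate is constantly 0 along the curve. Only differentiability at 0 is
    asked, so that curves not known to be smooth are allowed. *)
Lemma chart_derivative_curve {R : realType} (S : set 'rV[R]_3) y V W F G
    (c : R -> 'rV[R]_3) :
  surface_chart S y V W F G -> differentiable c 0 -> c 0 = y ->
  (\forall t \near (0 : R), S (c t)) -> ('d F y ('d c 0 1)) 0 2 = 0.
Proof.
move=> [_ [oV Vy] oW [sF _ _ _] SF] dc c0 Sc; rewrite -c0 in Vy *.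
have dF := smooth_on_differentiable _ _ _ sF Vy.
have dFc : differentiable (F \o c) 0 by exact: differentiable_comp.
have dd := is_diff_dotv (delta_mx 0 2) ((F \o c) 0).
have ddd := is_diff_comp (differentiableP dFc) dd.
have -> : 'd F (c 0) ('d c 0 1) = 'd (F \o c) 0 1.
  by have := diff_comp dc dF => /(congr1 (fun k => k 1)).
have [dphi vphi] := ddd.
have := congr1 (fun k => k 1) vphi; rewrite /= -deriveE // -(coordE 2) => <-.
rewrite -[RHS](derive_cst (0 : R^o) (0 : R^o) (1 : R^o)).
apply: near_eq_derive; near=> t.
have Vc : V (c t).
  near: t; have cc : {for 0, continuous c} by exact: differentiable_continuous.
  by apply: (cc V); exact: open_nbhs_nbhs.
by apply/SF => //; near: t.
Unshelve. all: by end_near. Qed.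

(** Turns the definition by curves into a linear condition. For the converse, the image under [G] of
    the straight line through [F y] in the direction ['d F y v] remains in [S], since this direction
    is horizontal. *)
Lemma tangent_vector_chart {R : realType} (S : set 'rV[R]_3) y V W F G v :
  surface_chart S y V W F G ->
  tangent_vector S y v <-> ('d F y v) 0 2 = 0.
Proof.
move=> ch; have [Sy [oV Vy] oW dFG SF] := ch; have [sF sG FK GK] := dFG.
have [WFy GFy] := FK y Vy; split.
  move=> [c [e [e0 sc Sc c0 c'0]]].
  have I0 : `]- e, e[%classic (0 : R) by rewrite /= in_itv /= oppr_lt0 e0.
  have dc : differentiable (c : R^o -> _) (0 : R^o) by exact: smooth_on_differentiable sc I0.
  rewrite -c'0 derive1E'//.
  apply: (chart_derivative_curve _ _ _ _ _ _ _ ch) => //.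
  have nI : \forall t \near (0 : R), `|t| < e by exact: nbhs0_lt.
  by apply: filterS nI => t te; apply: Sc; rewrite /= in_itv /= -ltr_norml.
move=> Fv; set w := 'd F y v in Fv.
have Gw : 'd G (F y) w = v by exact: diffeomorphism_diffK oV dFG Vy.
have W0 : W (F y + (0 : R) *: w) by rewrite scale0r addr0.
have /nbhs_ballP[e /= e0 eW] := near_line W (F y) w 0 oW W0.
have eW' t : `]- e, e[%classic t -> W (F y + t *: w).
  rewrite /= in_itv /= => te; apply: eW.
  by rewrite -ball_normE /= sub0r normrN ltr_norml.
exists (fun s : R => G (F y + s *: w)), e; split=> //.
- exact: smooth_on_line eW'.
- move=> t te; have [Vt FGt] := GK _ (eW' t te).
  apply/SF => //; rewrite FGt !mxE Fv mulr0 addr0.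
  exact/SF.
- by rewrite scale0r addr0.
- have dG := smooth_on_differentiable _ _ _ sG W0.
  have [dl vl] := is_diff_line G (F y) w 0 dG.
  rewrite derive1E'// vl scale1r.
  by rewrite scale0r addr0.
Qed.

(** * Local connectedness of surfaces *)

(** [nu] is the gradient at [y] of the third coordinate of [F]. It is nonzero because ['d F y] has
    ['d G (F y)] as a right inverse. *)
Lemma chart_kernel_normal {R : realType} (S : set 'rV[R]_3) y V W F G :
  surface_chart S y V W F G ->
  exists2 nu : 'rV[R]_3, nu != 0 & forall v, ('d F y v) 0 2 = dotv nu v.
Proof.
move=> [Sy [oV Vy] oW dFG SF]; have [sF sG FK GK] := dFG.
have [WFy GFy] := FK y Vy.
pose nu : 'rV[R]_3 := \row_i ('d F y (delta_mx 0 i)) 0 2.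
have nuE v : ('d F y v) 0 2 = dotv nu v.
  rewrite [in LHS](row_sum_delta v) linear_sum summxE /dotv.
  by apply: eq_bigr => i _; rewrite linearZ !mxE mulrC.
exists nu => //; apply/eqP => nu0.
have dd : 'd F y ('d G (F y) (delta_mx 0 2)) = delta_mx 0 2.
  have := diffeomorphism_diffK _ _ _ _ _ (delta_mx 0 2) oW
    (diffeomorphism_sym _ _ _ _ dFG) WFy.
  by rewrite GFy.
have := etrans (esym (nuE _)) (congr1 (fun u : 'rV[R]_3 => u 0 2) dd).
rewrite nu0 dotvE !mxE !mul0r !addr0 => /eqP.
by rewrite eq_sym oner_eq0.
Qed.

Lemma embedded_surface_chart {R : realType} (S : set 'rV[R]_3) y :
  embedded_surface S -> S y -> exists V W F G, surface_chart S y V W F G.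
Proof.
move=> eS Sy; have [V [W [F [G [oV Vy oW dFG SF]]]]] := eS y Sy.
by exists V, W, F, G.
Qed.

Lemma tangent_normal {R : realType} (S : set 'rV[R]_3) y :
  embedded_surface S -> S y ->
  exists2 nu : 'rV[R]_3, nu != 0 &
    forall v, tangent_vector S y v <-> dotv nu v = 0.
Proof.
move=> eS Sy; have [V [W [F [G ch]]]] := embedded_surface_chart _ _ eS Sy.
have [nu nu0 nuE] := chart_kernel_normal _ _ _ _ _ _ ch.
by exists nu => // v; rewrite -nuE; exact: tangent_vector_chart ch.
Qed.

(** The part [w] of [n] orthogonal to [nu] is orthogonal to itself, so [n] is a nonzero multiple of
    [nu]. *)
Lemma orthogonal_sub {R : realType} (nu n : 'rV[R]_3) :
  nu != 0 -> n != 0 -> (forall v, dotv nu v = 0 -> dotv n v = 0) ->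
  forall v, dotv n v = 0 -> dotv nu v = 0.
Proof.
move=> nu0 n0 sub; pose k := dotv n nu / dotv nu nu.
have dnu : dotv nu nu != 0 by rewrite gt_eqF// dotv_gt0.
pose w := n - k *: nu.
have nuw : dotv nu w = 0.
  by rewrite /w linearB linearZ /= /GRing.scale /= mulfVK// [dotv n _]dotvC subrr.
have w0 : w = 0.
  apply/eqP; apply: contraT => /dotv_gt0.
  by rewrite {1}/w dotvC linearB linearZ /= dotvC (sub _ nuw) [dotv w nu]dotvC nuw scaler0 subrr ltxx.
have nE : n = k *: nu by apply/eqP; rewrite -subr_eq0 -/w w0.
have k0 : k != 0 by apply: contraNneq n0 => k0; rewrite nE k0 scale0r.
move=> v; rewrite nE dotvC linearZ /= => /eqP.
by rewrite scaler_eq0 (negbTE k0) dotvC => /eqP.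
Qed.

Lemma connected_segments {R : realType} {V : normedModType R} (A : set V) (x0 : V) :
  (forall y, A y -> exists K, [/\ connected K, K x0, K y & K `<=` A]) ->
  connected A.
Proof.
move=> AK; have -> : A = \bigcup_(K in [set K | [/\ connected K, K x0 & K `<=` A]]) K.
  apply/seteqP; split => [y /AK[K [cK Kx Ky KA]]|y [K [_ _ KA] /KA//]].
  by exists K.
by apply: bigcup_connected; [exists x0 => K []|move=> K []].
Qed.

Lemma connected_segment {R : realType} {V : normedModType R} (x w : V) (a b : R) :
  connected [set x + t *: w | t in `[a, b]].
Proof.
apply: connected_continuous_connected; first exact: segment_connected.
apply: continuous_subspaceT => t; apply: differentiable_continuous.
by have [] := is_diff_line id x w t _.
Qed.

Lemma connected_convex {R : realType} {V : normedModType R} (A : set V) :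
  (forall x y t, A x -> A y -> 0 <= t <= 1 -> A (x + t *: (y - x))) ->
  connected A.
Proof.
move=> cA; have [->|/set0P[x0 Ax0]] := eqVneq A set0; first exact: connected0.
apply: (connected_segments _ x0) => y Ay.
exists [set x0 + t *: (y - x0) | t in `[0, 1]]; split.
- exact: connected_segment.
- by exists 0; rewrite ?scale0r ?addr0//= in_itv /= lexx ler01.
- by exists 1; rewrite ?scale1r ?subrKC//= in_itv /= lexx ler01.
- by move=> _ [t /= t01 <-]; apply: cA.
Qed.

Lemma ball_convex {R : realType} {V : normedModType R} (p : V) r (x y : V) t :
  ball p r x -> ball p r y -> 0 <= t <= 1 -> ball p r (x + t *: (y - x)).
Proof.
rewrite -ball_normE /= => px py /andP[t0 t1].
have -> : p - (x + t *: (y - x)) = (1 - t) *: (p - x) + t *: (p - y).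
  rewrite scalerBl scale1r -addrA [- (t *: _) + _]addrC -scalerBr.
  rewrite (_ : p - y - (p - x) = x - y); last by rewrite opprB addrC addrA subrK.
  by rewrite opprD addrA -scalerN opprB.
apply: le_lt_trans (ler_normD _ _) _.
rewrite !normrZ !ger0_norm ?subr_ge0//.
have [->|t0'] := eqVneq t 0; first by rewrite subr0 mul1r mul0r addr0.
rewrite -[ltRHS](subrK (t * r)) -{1}[r]mul1r -mulrBl; apply: ler_ltD.
  by apply: ler_wpM2l; [rewrite subr_ge0|exact: ltW].
by rewrite ltr_pM2l// lt_neqAle eq_sym t0'.
Qed.

Lemma chart_slice {R : realType} (S : set 'rV[R]_3) y V W F G (Om : set 'rV[R]_3) :
  surface_chart S y V W F G -> nbhs (F y) Om -> Om `<=` W ->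
  nbhs y (V `&` F @^-1` Om) /\
  (V `&` F @^-1` Om) `&` S = G @` (Om `&` [set x | x 0 2 = 0]).
Proof.
move=> [Sy [oV Vy] oW [sF sG FK GK] SF] nOm OmW; split.
  apply: filterI; first exact: open_nbhs_nbhs.
  have cF : {for y, continuous F}.
    by apply: differentiable_continuous; exact: smooth_on_differentiable sF Vy.
  exact: (cF Om).
apply/seteqP; split=> [z [[Vz Oz] Sz]|_ [x [Ox x2] <-]].
  exists (F z); first by split=> //=; apply/SF.
  by case: (FK z Vz).
have [VG FG] := GK x (OmW _ Ox).
split; last by apply/SF; rewrite ?FG.
by split=> //=; rewrite /preimage /= FG.
Qed.

Lemma chart_inverse_continuous {R : realType} (S : set 'rV[R]_3) y V W F G :
  surface_chart S y V W F G -> forall x, W x -> {for x, continuous G}.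
Proof.
move=> [_ _ _ [_ sG _ _] _] x Wx.
by apply: differentiable_continuous; exact: smooth_on_differentiable sG Wx.
Qed.

Lemma chart_image_connected {R : realType} (S : set 'rV[R]_3) y V W F G K :
  surface_chart S y V W F G -> K `<=` W -> connected K -> connected (G @` K).
Proof.
move=> ch KW cK; apply: connected_continuous_connected => //.
apply: continuous_in_subspaceT => x /set_mem /KW Wx.
exact: chart_inverse_continuous ch x Wx.
Qed.

Lemma surface_locally_connected {R : realType} (S : set 'rV[R]_3) y :
  embedded_surface S -> S y -> locally_connected_in S y.
Proof.
move=> eS Sy O yO; have [V [W [F [G ch]]]] := embedded_surface_chart _ _ eS Sy.
have [_ [oV Vy] oW [sF sG FK GK] SF] := ch.
have [WFy GFy] := FK y Vy.
have nW : nbhs (F y) (W `&` G @^-1` O).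
  apply: filterI; first exact: open_nbhs_nbhs.
  have cG := chart_inverse_continuous _ _ _ _ _ _ ch _ WFy.
  by apply: (cG O); rewrite GFy.
have [r /= r0 rW] := (nbhs_ballP _ _).1 nW.
have BW : ball (F y) r `<=` W by move=> x /rW[].
have [nN NS] := chart_slice _ _ _ _ _ _ _ ch (nbhsx_ballx (F y) r r0) BW.
exists (O `&` (V `&` F @^-1` ball (F y) r)); split.
- exact: filterI.
- by move=> z [].
- have -> : O `&` (V `&` F @^-1` ball (F y) r) `&` S =
      (V `&` F @^-1` ball (F y) r) `&` S.
    rewrite -setIA NS; apply/setIidPr => _ [x [Bx _] <-].
    by case: (rW x Bx).
  rewrite NS; apply: (chart_image_connected _ _ _ _ _ _ _ ch).
    by move=> x [/BW].
  apply: connected_convex => x z t [Bx /= x2] [Bz /= z2] t01; split.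
    exact: ball_convex.
  by rewrite /= !mxE x2 z2 subrr mulr0 addr0.
Qed.

(** * Sublevel sets at regular points *)

Lemma lt_along_line {R : realType} {V : normedModType R} (g : V -> R^o) (B : set V)
    (x w : V) (a b : R) :
  (forall z, B z -> differentiable g z) -> (forall z, B z -> 0 < 'D_w g z) ->
  a < b -> (forall t : R, a <= t <= b -> B (x + t *: w)) ->
  g (x + a *: w) < g (x + b *: w).
Proof.
move=> dg Dg ab Bab; pose k t : R := g (x + t *: w).
have dk t : a <= t <= b -> is_diff t (k : R -> R^o) (fun h => h *: 'd g (x + t *: w) w).
  by move=> /Bab Bt; apply: is_diff_line; exact: dg.
suff : {in `[a, b] &, {homo k : s t / s < t}}.
  by apply => //; rewrite in_itv /= lexx ltW.
apply: gtr0_derive1_lt_cc => [t /[!in_itv]/= /andP[at_ tb]|t /[!in_itv]/= /andP[at_ tb]|].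
- apply/derivable1_diffP.
  by have [] := dk t (introT andP (conj (ltW at_) (ltW tb))).
- have tab := introT andP (conj (ltW at_) (ltW tb)).
  have [dkt vkt] := dk t tab.
  rewrite derive1E'// vkt scale1r -deriveE; last exact/dg/Bab.
  exact/Dg/Bab.
- apply: continuous_in_subspaceT => t /set_mem /=; rewrite in_itv /= => tab.
  by apply: differentiable_continuous; have [] := dk t tab.
Qed.

Lemma near0_line {R : realType} {V : normedModType R} (A : set V) (x w : V) :
  nbhs x A -> exists2 e : R, 0 < e & forall t, `|t| <= e -> A (x + t *: w).
Proof.
move=> xA.
have c : {for 0, continuous (fun s : R => x + s *: w)}.
  by apply: differentiable_continuous; have [] := is_diff_line id x w 0 _.
have := c A; rewrite scale0r addr0 => /(_ xA) /nbhs_ballP[e /= e0 eA].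
exists (e / 2); first by rewrite divr_gt0.
move=> t te; apply: eA; rewrite -ball_normE /= sub0r normrN.
by apply: le_lt_trans te _; rewrite ltr_pdivrMr// ltr_pMr// ltr1n.
Qed.

(** In a chart, [dotv n] increases along the image [w] of [v]. In a tube around a short segment of
    direction [w], each point of the sublevel set can slide down to the low end of the tube, which
    is convex and lies wholly in the strict sublevel set. *)
Lemma regular_sublevel_tangent {R : realType} (S : set 'rV[R]_3) y n v :
  embedded_surface S -> S y -> tangent_vector S y v -> 0 < dotv n v ->
  regular_sublevel S (dotv n) y.
Proof.
move=> eS Sy; have [V [W [F [G ch]]]] := embedded_surface_chart _ _ eS Sy.
move=> /(tangent_vector_chart _ _ _ _ _ _ _ ch).
have [_ [oV Vy] oW dFG SF] := ch; have [sF sG FK GK] := dFG.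
have [WFy GFy] := FK y Vy.
set p := F y in WFy GFy *; set w := 'd F y v => w2 nv.
have p2 : p 0 2 = 0 by exact/SF.
pose g : 'rV[R]_3 -> R^o := dotv n \o G.
have dg z : W z -> differentiable g z.
  move=> Wz; apply: differentiable_comp.
    exact: smooth_on_differentiable sG Wz.
  by have [] := is_diff_dotv n (G z).
have Dg z : W z -> 'D_w g z = dotv n ('D_w G z).
  move=> Wz; have dG := smooth_on_differentiable _ _ _ sG Wz.
  have dn := is_diff_dotv n (G z).
  have [dgz vgz] := is_diff_comp (differentiableP dG) dn.
  rewrite deriveE//; have := congr1 (fun k => k w) vgz => /= ->.
  by rewrite deriveE.
have cDg : {for p, continuous (fun z => dotv n ('D_w G z) : R^o)}.
  apply: continuous_comp; last exact: continuous_dotv.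
  by apply: differentiable_continuous; exact: (sG [:: w]).
have Dp : 0 < dotv n ('D_w G p).
  rewrite deriveE; last exact: smooth_on_differentiable sG WFy.
  have -> : 'd G p w = v by exact: diffeomorphism_diffK oV dFG Vy.
  by [].
have nD : nbhs p (W `&` [set z | 0 < dotv n ('D_w G z)]).
  apply: filterI; first exact: open_nbhs_nbhs.
  by apply: (cDg [set r | 0 < r]); apply: open_nbhs_nbhs; split=> //; exact: open_gt.
have [r /= r0 rD] := (nbhs_ballP _ _).1 nD.
have BW z : ball p r z -> W z by move=> /rD[].
have r20 : 0 < r / 2 by rewrite divr_gt0.
have [tau tau0 ptau] := near0_line _ p w (nbhsx_ballx p (r / 2) r20).
have tau_itv t : - tau <= t <= tau -> `|t| <= tau by rewrite ler_norml.
pose c0 : R := dotv n y.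
have gp : g p = c0 by rewrite /g /= GFy.
have r2r : ball p (r / 2) `<=` ball p r.
  by apply: le_ball; rewrite ler_pdivrMr// ler_pMr// ler1n.
have incr x a b : (forall t : R, a <= t <= b -> ball p r (x + t *: w)) ->
    a < b -> g (x + a *: w) < g (x + b *: w).
  move=> xB ab; apply: (lt_along_line _ (ball p r)) => // z /rD[Wz Dz].
    exact: dg.
  by rewrite Dg.
set x0 := p + (- tau) *: w.
have gx0 : g x0 < c0.
  have := incr p (- tau) 0; rewrite scale0r addr0 gp; apply; last by rewrite oppr_lt0.
  move=> t /andP[t1 t2]; apply/r2r/ptau/tau_itv; rewrite t1 /=.
  exact: le_trans t2 (ltW tau0).
have Wx0 : W x0 by apply/BW/r2r/ptau; rewrite normrN ger0_norm// ltW.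
have ngx0 : nbhs x0 [set z | g z < c0].
  have cg := differentiable_continuous (dg _ Wx0).
  by apply: (cg [set r | r < c0]); apply: open_nbhs_nbhs; split=> //; exact: open_lt.
have [d1 /= d10 d1g] := (nbhs_ballP _ _).1 ngx0.
set d := Num.min d1 (r / 2).
have d0 : 0 < d by rewrite lt_min d10.
have low x : ball p d x -> g (x + (- tau) *: w) < c0.
  move=> px; apply: d1g; move: px; rewrite -!ball_normE /= lt_min => /andP[px _].
  by rewrite /x0 opprD addrACA subrr addr0.
(* The tube: the ball of radius [d] swept along [w]. The bound [d <= d1] puts the end at [- tau]
   below level [c0]; the bounds by [r / 2] keep the tube in the ball where [g] increases along
   [w]. *)
pose Om := [set x | exists2 s, - tau <= s <= tau & ball p d (x - s *: w)].
have OmI x s : - tau <= s <= tau -> ball p d x -> Om (x + s *: w).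
  by move=> sI px; exists s; rewrite ?addrK.
have OmB : Om `<=` ball p r.
  move=> x [s sI]; have := ptau s (tau_itv s sI).
  rewrite -!ball_normE /= lt_min => ps /andP[_ px].
  rewrite [r]splitr; apply: le_lt_trans (ltrD px ps).
  rewrite (_ : p - (p + s *: w) = - (s *: w)) ?normrN; last first.
    by rewrite opprD addrA subrr add0r.
  rewrite (_ : p - x = (p - (x - s *: w)) - s *: w); first exact: ler_normB.
  by rewrite opprB addrA addrAC addrK.
have nOm : nbhs p Om.
  apply: filterS (nbhsx_ballx p d d0) => x px; exists 0; last by rewrite scale0r subr0.
  by rewrite oppr_le0 ltW.
have incr_Om x a b : ball p d x -> - tau <= a -> a < b -> b <= tau ->
    g (x + a *: w) < g (x + b *: w).
  move=> px ta ab bt; apply: incr => // t /andP[at_ tb]; apply/OmB/OmI => //.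
  by rewrite (le_trans ta at_) (le_trans tb bt).
have [nN NS] := chart_slice _ _ _ _ _ _ _ ch nOm (subset_trans OmB BW).
pose K := Om `&` [set x | x 0 2 = 0] `&` [set x | g x < c0].
have GK' : G @` K = (V `&` F @^-1` Om) `&` S `&` [set z | dotv n z < dotv n y]
  by rewrite NS; apply/seteqP; split=> [_ [x [Ox gx] <-]|_ [[x Ox <-] gx]];
     [split=> //; exists x|exists x].
have down (x : 'rV[R]_3) (s : R) : x 0 2 = 0 -> (x + s *: w) 0 2 = 0
  by move=> x2; rewrite !mxE w2 mulr0 addr0.
have comb (u z : 'rV[R]_3) (t : R) : u 0 2 = 0 -> z 0 2 = 0 ->
    (u + t *: (z - u)) 0 2 = 0
  by move=> u2 z2; rewrite !mxE u2 z2 subrr mulr0 addr0.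
exists (V `&` F @^-1` Om); split=> //.
- rewrite -GK'; apply: (chart_image_connected _ _ _ _ _ _ _ ch).
    by move=> x [[/OmB/BW]].
  apply: (connected_segments _ x0) => x [[[s sI px] /= x2] /= gx].
  pose x' := x - s *: w; have x'2 : x' 0 2 = 0 by rewrite /x' -scaleNr; exact: down.
  have xE : x = x' + s *: w by rewrite /x' subrK.
  have [ts st] := andP sI.
  have tauI : - tau <= - tau <= tau by rewrite lexx /= ge0_cp// ltW.
  (* Slide from [x] down to the low end, then follow a segment inside it to [x0]. *)
  exists ([set x' + t *: w | t in `[- tau, s]] `|`
          [set (x' + (- tau) *: w) + t *: (p - x') | t in `[0, 1]]); split.
  + apply: connectedU; try exact: connected_segment.
    exists (x' + (- tau) *: w); split; first by exists (- tau); rewrite //= in_itv /= lexx.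
    by exists 0; rewrite ?scale0r ?addr0//= in_itv /= lexx ler01.
  + right; exists 1; first by rewrite /= in_itv /= lexx ler01.
    by rewrite scale1r addrAC subrKC.
  + by left; exists s; rewrite // /= in_itv /= lexx ts.
  + move=> _ [[t /= /[!in_itv]/= /andP[t1 t2] <-]|[t /= /[!in_itv]/= t01 <-]].
      split; first split; [|exact: down|].
        by apply: OmI => //; rewrite t1 (le_trans t2).
      rewrite /=; move: t2; rewrite le_eqVlt => /predU1P[->|t2]; first by rewrite -xE.
      by apply: lt_trans gx; rewrite xE; exact: incr_Om.
    rewrite addrAC.
    have pu : ball p d (x' + t *: (p - x')) by apply: ball_convex => //; exact: ballxx.
    split; first split; [exact: OmI| |exact: low].
    by apply: down; exact: comb.
- rewrite -GK' NS => _ [[x [Ox x2] <-] /=]; rewrite le_eqVlt => /predU1P[gx|gx]; last first.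
    by apply: subset_closure; exists x.
  have Wx := BW _ (OmB _ Ox).
  have [s sI px] := Ox; have [ts st] := andP sI.
  pose x' := x - s *: w; have x'2 : x' 0 2 = 0 by rewrite /x' -scaleNr; exact: down.
  have xE : x = x' + s *: w by rewrite /x' subrK.
  have ts' : - tau < s.
    rewrite lt_neqAle ts andbT; apply/eqP => tsE.
    by have := low x' px; rewrite tsE -xE /g /= gx ltxx.
  move=> B GB; have cG := chart_inverse_continuous _ _ _ _ _ _ ch _ Wx.
  have [e e0 eB] := near0_line _ x w (cG _ GB).
  (* A descent by [a] stays in the given neighbourhood and in the tube. It is positive since a point
     at level [c0] is not at the low end. *)
  pose a := Num.min e (s + tau).
  have a0 : 0 < a by rewrite lt_min e0 /=; lra.
  have ae : a <= e by rewrite ge_min lexx.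
  have at_ : a <= s + tau by rewrite ge_min lexx orbT.
  have xaE : x + (- a) *: w = x' + (s - a) *: w by rewrite xE -addrA -scalerDl.
  exists (G (x + (- a) *: w)); split; last by apply: eB; rewrite normrN ger0_norm// ltW.
  exists (x + (- a) *: w) => //; split; first split; [|exact: down|].
    by rewrite xaE; apply: OmI => //; apply/andP; split; lra.
  have : g (x' + (s - a) *: w) < g (x' + s *: w) by apply: incr_Om => //; lra.
  by rewrite -xaE -xE [X in _ < X]gx.
Qed.

(** * Sublevel sets at critical points and supporting planes *)

Lemma dotvN {R : realType} (n v : 'rV[R]_3) : dotv (- n) v = - dotv n v.
Proof. by rewrite dotvC linearN /= dotvC. Qed.

Definition half_disk {R : realType} (p : 'rV[R]_3) (r : R) (m : 'rV[R]_3) :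
    set 'rV[R]_3 :=
  ball p r `&` [set x | x 0 2 = 0] `&` [set x | 0 < dotv m (x - p)].

Lemma half_disk_connected {R : realType} (p : 'rV[R]_3) (r : R) (m : 'rV[R]_3) :
  connected (half_disk p r m).
Proof.
apply: connected_convex => x y t [[px /= x2] /= mx] [[py /= y2] /= my] t01.
split; first split.
- exact: ball_convex.
- by rewrite /= !mxE x2 y2 subrr mulr0 addr0.
- rewrite /=; have -> : dotv m (x + t *: (y - x) - p) =
      (1 - t) * dotv m (x - p) + t * dotv m (y - p).
    by rewrite !dotvE !mxE; ring.
  have /andP[t0 t1] := t01.
  have [->|t0'] := eqVneq t 0; first by rewrite subr0 mul1r mul0r addr0.
  apply: ltr_wpDl; first by rewrite mulr_ge0 ?subr_ge0// ltW.
  by rewrite mulr_gt0// lt_neqAle eq_sym t0'.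
Qed.

Lemma half_disk_meet {R : realType} (p : 'rV[R]_3) (r : R) (m1 m2 : 'rV[R]_3) :
  0 < r -> p 0 2 = 0 -> m1 0 2 = 0 -> m2 0 2 = 0 -> m1 != 0 -> m2 != 0 ->
  dotv m1 m2 = 0 -> (half_disk p r m1 `&` half_disk p r m2) !=set0.
Proof.
move=> r0 p2 m12 m22 m10 m20 m1m2.
have [e e0 eB] := near0_line _ p (m1 + m2) (nbhsx_ballx p r r0).
have Bx : ball p r (p + e *: (m1 + m2)) by apply: eB; rewrite ger0_norm// ltW.
have x2 : (p + e *: (m1 + m2)) 0 2 = 0 by rewrite !mxE p2 m12 m22 addr0 mulr0 addr0.
exists (p + e *: (m1 + m2)); split; split => //=.
  rewrite addrAC subrr add0r linearZ linearD /= m1m2 addr0.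
  by apply: mulr_gt0 => //; exact: dotv_gt0.
rewrite addrAC subrr add0r linearZ linearD /= dotvC m1m2 add0r.
by apply: mulr_gt0 => //; exact: dotv_gt0.
Qed.

(** Four convex half disks, bounded by the two coordinate directions through [p], cover it, and two
    of them with orthogonal normals always meet. *)
Lemma punctured_disk_connected {R : realType} (p : 'rV[R]_3) (r : R) :
  0 < r -> p 0 2 = 0 ->
  connected (ball p r `&` [set x | x 0 2 = 0] `\ p).
Proof.
move=> r0 p2; set a : 'rV[R]_3 := delta_mx 0 0; set b : 'rV[R]_3 := delta_mx 0 1.
have d0 (i : 'I_3) : (delta_mx 0 i : 'rV[R]_3) != 0.
  by apply/eqP => /rowP/(_ i)/eqP; rewrite !mxE !eqxx oner_eq0.
have -> : ball p r `&` [set x | x 0 2 = 0] `\ p =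
    (half_disk p r a `|` half_disk p r b) `|`
    (half_disk p r (- a) `|` half_disk p r (- b)).
  have nep m x : half_disk p r m x -> x <> p.
    by move=> [_ /=] /[swap] ->; rewrite subrr linear0 ltxx.
  apply/seteqP; split => [x [Bx xp]|x].
    have [x0|x0|] := ltgtP (x 0 0) (p 0 0).
    - by right; left; split=> //=; rewrite dotvN -coordE !mxE; lra.
    - by left; left; split=> //=; rewrite -coordE !mxE; lra.
    have [x1|x1|] := ltgtP (x 0 1) (p 0 1).
    - by right; right; split=> //=; rewrite dotvN -coordE !mxE; lra.
    - by left; right; split=> //=; rewrite -coordE !mxE; lra.
    move=> x1 x0; exfalso; apply: xp; apply: rv3P => //.
    by case: Bx => _ /= ->.
  by move=> [[]|[]] Hx; split; [case: Hx|exact: nep Hx|case: Hx|exact: nep Hx|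
    case: Hx|exact: nep Hx|case: Hx|exact: nep Hx].
have ab : dotv a b = 0 by rewrite dotvE !mxE /=; ring.
have a2 : a 0 2 = 0 by rewrite mxE.
have b2 : b 0 2 = 0 by rewrite mxE.
have Na2 : (- a) 0 2 = 0 by rewrite mxE a2 oppr0.
have Nb2 : (- b) 0 2 = 0 by rewrite mxE b2 oppr0.
have Na0 : - a != 0 by rewrite oppr_eq0; exact: d0.
have Nb0 : - b != 0 by rewrite oppr_eq0; exact: d0.
apply: connectedU; first 1 last.
- apply: connectedU; try exact: half_disk_connected.
  by apply: half_disk_meet => //; exact: d0.
- apply: connectedU; try exact: half_disk_connected.
  by apply: half_disk_meet => //; rewrite dotvN linearN /= ab !oppr0.
- have [|x [ax bx]] := half_disk_meet p r a (- b) r0 p2 a2 Nb2 (d0 0) Nb0.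
    by rewrite linearN /= ab oppr0.
  by exists x; split; [left|right].
Qed.

(** By strict convexity [dotv n] takes the value [dotv n y] on [S] near [y] only at [y]. On the
    punctured disk, which is connected, the difference therefore keeps one sign. If the sign is
    negative, the local strict sublevel set is the entire punctured disk, whence regularity. *)
Lemma critical_extremum {R : realType} (S : set 'rV[R]_3) (y n : 'rV[R]_3) :
  embedded_surface S -> strictly_convex S -> S y -> n != 0 ->
  (forall v, tangent_vector S y v -> dotv n v = 0) ->
  strict_local_min S (dotv n) y \/
  (strict_local_min S (dotv (- n)) y /\ regular_sublevel S (dotv n) y).
Proof.
move=> eS cS Sy n0 nt.
(* The hypothesis only places the tangent plane inside the orthogonal complement of [n]; the
   converse inclusion is needed to recognize a point at the level of [y] as a point of the tangent
   plane. *)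
have touch : \forall x \near y, S x -> dotv n x = dotv n y -> x = y.
  have [nu nu0 nuE] := tangent_normal S y eS Sy.
  have nnu : forall v, dotv n v = 0 -> dotv nu v = 0.
    by apply: orthogonal_sub => // v /nuE/nt.
  apply: filterS (cS y Sy) => x xy Sx nx; apply: xy => //.
  by apply/nuE/nnu; rewrite linearB /= nx subrr.
have [V [W [F [G ch]]]] := embedded_surface_chart _ _ eS Sy.
have [_ [oV Vy] oW dFG SF] := ch; have [sF sG FK GK] := dFG.
have [WFy GFy] := FK y Vy.
set p := F y in WFy GFy *.
have p2 : p 0 2 = 0 by exact/SF.
have nW : nbhs p (W `&` G @^-1` [set x | S x -> dotv n x = dotv n y -> x = y]).
  apply: filterI; first exact: open_nbhs_nbhs.
  have cG := chart_inverse_continuous _ _ _ _ _ _ ch _ WFy.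
  by apply: (cG [set x | S x -> dotv n x = dotv n y -> x = y]); rewrite GFy.
have [r /= r0 rW] := (nbhs_ballP _ _).1 nW.
have BW : ball p r `<=` W by move=> x /rW[].
have [nN NS] := chart_slice _ _ _ _ _ _ _ ch (nbhsx_ballx p r r0) BW.
set N := V `&` _ in nN NS.
set D := ball p r `&` [set x | x 0 2 = 0] in NS.
have cD := punctured_disk_connected p r r0 p2; rewrite -/D in cD.
have GS x : D x -> S (G x).
  by move=> Dx; have : (N `&` S) (G x) by [rewrite NS; exists x|]; case.
have GD x : (D `\ p) x -> dotv n (G x) != dotv n y.
  move=> [Dx /= xp]; apply/eqP => nx; apply: xp.
  have [Wx tx] := rW x Dx.1; have Gxy : G x = y by apply: tx => //; exact: GS.
  by have [_ <-] := GK x Wx; rewrite Gxy.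
have cGD : connected (G @` (D `\ p)).
  by apply: (chart_image_connected _ _ _ _ _ _ _ ch) => // x [[/BW]].
have cnGD : connected [set dotv n z | z in G @` (D `\ p)].
  apply: connected_continuous_connected => //.
  by apply: continuous_subspaceT; exact: continuous_dotv.
have /connected_intervalP iv := cnGD.
have NSp z : N z -> S z -> z = y \/ (G @` (D `\ p)) z.
  move=> Nz Sz; have [x Dx xz] : (G @` D) z by rewrite -NS.
  have [xp|xp] := pselect (x = p); first by left; rewrite -xz xp.
  by right; exists x.
have [[x1 [Dx1 lt1]]|nlt] := pselect (exists x, (D `\ p) x /\ dotv n (G x) < dotv n y).
  have lt x : (D `\ p) x -> dotv n (G x) < dotv n y.
    move=> Dx; rewrite lt_neqAle GD//= leNgt; apply/negP => gt.
    have [z [x' Dx' <-] /eqP] : [set dotv n z | z in G @` (D `\ p)] (dotv n y).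
      apply: (iv (dotv n (G x1)) (dotv n (G x))); last by rewrite !ltW.
        by exists (G x1) => //; exists x1.
      by exists (G x) => //; exists x.
    by rewrite (negbTE (GD x' Dx')).
  right; split.
    apply: filterS nN => z Nz Sz; rewrite !dotvN lerN2.
    have [//|[x Dx <-]] := NSp z Nz Sz.
    by rewrite leNgt lt.
  have NSlt : N `&` S `&` [set z | dotv n z < dotv n y] = G @` (D `\ p).
    apply/seteqP; split=> [z [[Nz Sz] /=]|_ [x Dx <-]].
      by have [->|//] := NSp z Nz Sz; rewrite ltxx.
    by split; [rewrite NS; exists x => //; case: Dx|exact: lt].
  exists N; rewrite NSlt; split=> // z [[Nz Sz] _].
  have [->|] := NSp z Nz Sz; last exact: subset_closure.
  move=> B yB; have cG := chart_inverse_continuous _ _ _ _ _ _ ch _ WFy.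
  have nB : nbhs p (ball p r `&` G @^-1` B).
    by apply: filterI; [exact: nbhsx_ballx|apply: (cG B); rewrite GFy].
  have [e e0 eB] := near0_line _ p (delta_mx 0 0) nB.
  have [Be GB] : (ball p r `&` G @^-1` B) (p + e *: delta_mx 0 0).
    by apply: eB; rewrite ger0_norm// ltW.
  exists (G (p + e *: delta_mx 0 0)); split=> //; exists (p + e *: delta_mx 0 0) => //.
  split; first by split=> //=; rewrite !mxE p2 /= mulr0 addr0.
  move=> /= /rowP/(_ 0)/eqP.
  by rewrite !mxE /= mulr1 addrC -subr_eq0 addrK gt_eqF.
left; apply: filterS nN => z Nz Sz zy; have [//|[x Dx xz]] := NSp z Nz Sz.
exfalso; apply: nlt; exists x; split=> //.
by rewrite lt_neqAle GD //= xz.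
Qed.

Lemma surface_sublevel {R : realType} (S : set 'rV[R]_3) (y n : 'rV[R]_3) :
  embedded_surface S -> strictly_convex S -> S y -> n != 0 ->
  strict_local_min S (dotv n) y \/ regular_sublevel S (dotv n) y.
Proof.
move=> eS cS Sy n0.
have [nt|/existsNP[v /not_implyP[tv /eqP nv]]] :=
    pselect (forall v, tangent_vector S y v -> dotv n v = 0).
  by have [|[]] := critical_extremum S y n eS cS Sy n0 nt; [left|right].
right; have [nu nu0 nuE] := tangent_normal S y eS Sy.
have [v0|v0|v0] := ltgtP (dotv n v) 0; last by rewrite v0 eqxx in nv.
  apply: (regular_sublevel_tangent _ _ _ (- v)) => //.
    by apply/nuE; rewrite linearN /= (nuE v).1 ?oppr0.
  by rewrite linearN oppr_gt0.
exact: regular_sublevel_tangent v0.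
Qed.

Lemma strict_local_min_surface {R : realType} (S : set 'rV[R]_3) (y n : 'rV[R]_3) :
  closed_surface S -> strictly_convex S -> S y -> n != 0 ->
  strict_local_min S (dotv n) y ->
  forall x, S x -> x <> y -> dotv n y < dotv n x.
Proof.
move=> [_ kS connS eS] cS Sy n0 miny.
apply: (@strict_local_min_global R 'rV[R]_3 S (dotv n) y) => //.
- exact: continuous_dotv.
- by move=> z Sz; exact: surface_locally_connected.
- by move=> z Sz; exact: surface_sublevel.
Qed.

(** A strict local maximum of [dotv n] is a strict local minimum of [dotv (- n)], so the global
    argument is only needed for minima. *)
Lemma supporting_plane {R : realType} (S : set 'rV[R]_3) (y n : 'rV[R]_3) :
  closed_surface S -> strictly_convex S -> S y -> n != 0 ->
  (forall v, tangent_vector S y v -> dotv n v = 0) ->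
  (forall x, S x -> x <> y -> dotv n y < dotv n x) \/
  (forall x, S x -> x <> y -> dotv n x < dotv n y).
Proof.
move=> clS cS Sy n0 nt; have [_ _ _ eS] := clS.
have [miny|[maxy _]] := critical_extremum S y n eS cS Sy n0 nt.
  by left; exact: strict_local_min_surface.
right => x Sx xy; have Nn0 : - n != 0 by rewrite oppr_eq0.
have := strict_local_min_surface S y (- n) clS cS Sy Nn0 maxy x Sx xy.
by rewrite !dotvN ltrN2.
Qed.

(** * Lines parallel to the y-axis *)

Definition ey {R : realType} : 'rV[R]_3 := vec3 0 1 0.

Lemma eyE {R : realType} :
  (((@ey R) 0 0 = 0) * ((@ey R) 0 1 = 1) * ((@ey R) 0 2 = 0))%type.
Proof. by rewrite /ey !vec3E. Qed.

Lemma ey_unit {R : realType} (q : 'rV[R]_3) : dotv (q, @ey R).2 (q, @ey R).2 == 1.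
Proof. by rewrite dotvE /= !eyE; apply/eqP; ring. Qed.

Definition yline {R : realType} (q : 'rV[R]_3) : oriented_line R :=
  line_of (exist _ (q, ey) (ey_unit q)).

Lemma repr_line_of {R : realType} (x : unit_tangent R) :
  exists t, repr (line_of x) = geodesic_flow t x.
Proof.
have /eqmodP/asboolP : (repr (line_of x) = x %[mod oriented_line R])%qT by rewrite reprK.
move=> [t xE]; exists (- t).
by rewrite [in RHS]xE geodesic_flowD subrr geodesic_flow0.
Qed.

Lemma line_of_flow {R : realType} (t : R) (x : unit_tangent R) :
  line_of (geodesic_flow t x) = line_of x.
Proof.
apply/eqmodP/asboolP; exists (- t).
by rewrite geodesic_flowD subrr geodesic_flow0.
Qed.

Lemma yline_repr {R : realType} (q : 'rV[R]_3) :
  exists t, line_point (yline q) = q + t *: ey /\ line_dir (yline q) = ey.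
Proof.
rewrite /line_point /line_dir; have [t ->] := repr_line_of (exist _ (q, ey) (ey_unit q)).
by exists t.
Qed.

Lemma yline_dir {R : realType} (q : 'rV[R]_3) : line_dir (yline q) = ey.
Proof. by have [t []] := yline_repr q. Qed.

Lemma yline_set {R : realType} (q : 'rV[R]_3) :
  line_set (yline q) = [set q + t *: ey | t in setT].
Proof.
rewrite /line_set; have [t [-> ->]] := yline_repr q.
apply/seteqP; split=> [_ [s _ <-]|_ [s _ <-]].
  by exists (t + s) => //; rewrite scalerDl addrA.
by exists (s - t) => //; rewrite scalerBl -addrA subrKC.
Qed.

Lemma yline_translate {R : realType} (w q : 'rV[R]_3) :
  line_translate w (yline q) = yline (q + w).
Proof.
rewrite /line_translate; have [t ->] := repr_line_of (exist _ (q, ey) (ey_unit q)).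
rewrite /yline -(line_of_flow t (exist _ (q + w, ey) _)); congr line_of.
by apply/val_inj; rewrite /= /ut_point /ut_dir /= addrAC.
Qed.

(** Determinant of the projections to the plane [y = 0]. For lines directed by [ey], its sign is the
    orientation test of the billiard map, reversed as [det_ey] shows. *)
Definition det2 {R : realType} (u v : 'rV[R]_3) : R := u 0 0 * v 0 2 - u 0 2 * v 0 0.

Lemma det_ey {R : realType} (u v : 'rV[R]_3) :
  \det (\matrix_(i < 3) nth 0 [:: u; v; ey] i) = - det2 u v.
Proof.
rewrite (expand_det_row _ (2 : 'I_3)) (bigD1 (1 : 'I_3)) //= big1 => [|i].
  rewrite addr0 mxE /= eyE mul1r /cofactor (expand_det_row _ ord0).
  rewrite !big_ord_recl big_ord0 /cofactor !det_mx11 !mxE /=.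
  have -> : ((1 %% 3 + 1 %% 3) %% 3 + 1 %% 3)%N = 3%N by [].
  have -> : lift 1 ord0 = 0 :> 'I_3 by exact/val_inj.
  have -> : lift 1 (lift ord0 ord0) = 2 :> 'I_3 by exact/val_inj.
  rewrite [lift 1 (lift (lift _ _) _)](_ : _ = 0); last exact/val_inj.
  by rewrite /det2 /bump /=; ring.
by case: (ord3P i) => -> //= _; rewrite mxE /= eyE mul0r.
Qed.

Lemma det2Z {R : realType} (a b : R) (u v : 'rV[R]_3) :
  det2 (a *: u) (b *: v) = a * b * det2 u v.
Proof. by rewrite /det2 !mxE; ring. Qed.

(** A normal at [p] is orthogonal to [ey], so the mirror image of [p] is also in the tangent plane
    at [p]; that plane meets [S] only at [p]. *)
Lemma tangent_ey_reflect {R : realType} (S : set 'rV[R]_3) (p : 'rV[R]_3) :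
  closed_surface S -> strictly_convex S -> [set reflect_y z | z in S] = S ->
  S p -> tangent_vector S p ey -> p 0 1 = 0.
Proof.
move=> clS cS rS Sp tp; have [_ _ _ eS] := clS.
have [nu nu0 nuE] := tangent_normal S p eS Sp.
have nu1 : nu 0 1 = 0.
  by have /nuE := tp; rewrite dotvE !eyE !mulr0 mulr1 add0r addr0.
have Srp : S (reflect_y p) by rewrite -rS; exists p.
have nrp : dotv nu (reflect_y p) = dotv nu p.
  by rewrite !dotvE /reflect_y !vec3E nu1; ring.
have [rp|rp] := pselect (reflect_y p = p).
  have : - p 0 1 = p 0 1 by rewrite -[in RHS]rp /reflect_y vec3E.
  by lra.
have nt v : tangent_vector S p v -> dotv nu v = 0 by move/nuE.
by have [|] := supporting_plane S p nu clS cS Sp nu0 nt => /(_ _ Srp rp);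
  rewrite nrp ltxx.
Qed.

Lemma closest_yline {R : realType} (p q q' : 'rV[R]_3) : p 0 1 = q 0 1 ->
  closest_point (line_set (yline q)) p q' <-> q' = q.
Proof.
move=> pq; rewrite yline_set.
have dE (t : R) : dotv (p - (q + t *: ey)) (p - (q + t *: ey)) = dotv (p - q) (p - q) + t ^+ 2.
  by rewrite !dotvE !mxE /= pq; ring.
have d0 (u : 'rV[R]_3) : 0 <= dotv u u by rewrite dotvE -!expr2 !addr_ge0 ?sqr_ge0.
split.
  move=> [[t _ <-] /(_ q)]; rewrite /enorm ler_sqrt// dE.
  have Lq : [set q + s *: ey | s in setT] q by exists 0; rewrite ?scale0r ?addr0.
  move=> /(_ Lq); rewrite gerDl => t0.
  have /eqP : t ^+ 2 = 0 by apply/eqP; rewrite eq_le t0 sqr_ge0.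
  by rewrite sqrf_eq0 => /eqP ->; rewrite scale0r addr0.
move=> ->; split; first by exists 0; rewrite ?scale0r ?addr0.
by move=> _ [t _ <-]; rewrite /enorm ler_sqrt// dE lerDl sqr_ge0.
Qed.

Lemma yline_tangent {R : realType} (S : set 'rV[R]_3) (p q : 'rV[R]_3) :
  embedded_surface S -> S p -> line_set (yline q) `<=` tangent_plane S p ->
  tangent_vector S p (q - p) /\ tangent_vector S p ey.
Proof.
move=> eS Sp; rewrite yline_set => qS.
have [nu nu0 nuE] := tangent_normal S p eS Sp.
have t0 : tangent_vector S p (q - p).
  by apply: qS; exists 0; rewrite ?scale0r ?addr0.
have t1 : tangent_vector S p (q + ey - p).
  by apply: qS; exists 1; rewrite ?scale1r.
split=> //; apply/nuE; move/nuE: t1; rewrite addrAC linearD /= (nuE _).1//.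
by rewrite add0r.
Qed.

(** Projected along [ey], [S] lies on one side of the line through [q] and [p], by the supporting
    plane. Only the sign of [sg] matters: being the same for all points of [S], it will rule out a
    wrong positive tangency. *)
Lemma tangency_sign {R : realType} (S : set 'rV[R]_3) (p q q' : 'rV[R]_3) :
  closed_surface S -> strictly_convex S -> [set reflect_y z | z in S] = S ->
  lines_avoiding S (yline q) -> q 0 1 = 0 -> tangency S (yline q) p q' ->
  q' = q /\
  exists sg : R, forall s, S s -> s <> p -> 0 < sg * det2 (p - q) (s - q).
Proof.
move=> clS cS rS Lq q1 [Sp LS cq]; have [_ _ _ eS] := clS.
have [t0 t1] := yline_tangent S p q eS Sp LS.
have p1 := tangent_ey_reflect S p clS cS rS Sp t1.
split; first by apply/(closest_yline p q) => //; rewrite p1 q1.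
have pq : p != q.
  apply/eqP => pq; have : (line_set (yline q) `&` S) p.
    by split=> //; rewrite yline_set pq; exists 0; rewrite ?scale0r ?addr0.
  by rewrite Lq.
have [nu nu0 nuE] := tangent_normal S p eS Sp.
have nu1 : nu 0 1 = 0.
  by have /nuE := t1; rewrite dotvE !eyE !mulr0 mulr1 add0r addr0.
have := t0 => /nuE; rewrite dotvE nu1 !mxE => nupq.
set u0 := (p - q) 0 0; set u2 := (p - q) 0 2.
have nu_u : nu 0 0 * u0 + nu 0 2 * u2 = 0 by rewrite /u0 /u2 !mxE; lra.
have u1 : (p - q) 0 1 = 0 by rewrite !mxE p1 q1 oppr0 addr0.
have upos : 0 < u0 ^+ 2 + u2 ^+ 2.
  have := dotv_gt0 (p - q); rewrite subr_eq0 => /(_ pq).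
  by rewrite dotvE u1 mul0r addr0 -!expr2.
(* In the plane y = 0 the tangent plane at p is the line through p and q, so the
   linear forms [det2 (p - q)] and [dotv nu] are proportional. *)
pose m := nu 0 2 * u0 - nu 0 0 * u2.
have mE s : m * det2 (p - q) (s - q) = (u0 ^+ 2 + u2 ^+ 2) * (dotv nu s - dotv nu p).
  rewrite /m /det2 -/u0 -/u2 !dotvE nu1 !mul0r !addr0 ![(s - q) _ _]mxE ![(- q) _ _]mxE.
  have e : nu 0 0 * p 0 0 + nu 0 2 * p 0 2 = nu 0 0 * q 0 0 + nu 0 2 * q 0 2 by lra.
  rewrite e; set w0 := s 0 0 - q 0 0; set w2 := s 0 2 - q 0 2.
  have -> : nu 0 0 * s 0 0 + nu 0 2 * s 0 2 - (nu 0 0 * q 0 0 + nu 0 2 * q 0 2) =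
    nu 0 0 * w0 + nu 0 2 * w2 by rewrite /w0 /w2; ring.
  apply/eqP; rewrite -subr_eq0; apply/eqP.
  rewrite -[RHS](mulr0 (- (u2 * w2 + u0 * w0))) -nu_u; ring.
have nt v : tangent_vector S p v -> dotv nu v = 0 by move/nuE.
have [sup|sup] := supporting_plane S p nu clS cS Sp nu0 nt.
  exists m => s Ss sp; rewrite mE mulr_gt0// subr_gt0; exact: sup.
exists (- m) => s Ss sp; rewrite mulNr mE -mulrN mulr_gt0// opprB subr_gt0.
exact: sup.
Qed.

(** * The outer billiard map on lines parallel to the y-axis *)

Lemma tangent_at_min {R : realType} (S : set 'rV[R]_3) (p m v : 'rV[R]_3) :
  (forall s, S s -> dotv m p <= dotv m s) -> tangent_vector S p v ->
  dotv m v = 0.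
Proof.
move=> mp [c [e [e0 sc Sc c0 c'0]]].
have dphi (t : R) : `]- e, e[%classic t ->
    is_diff t (dotv m \o c : R -> R^o) (dotv m \o 'd c t).
  move=> te; have dc : differentiable (c : R^o -> _) (t : R^o).
    exact: smooth_on_differentiable sc te.
  exact: is_diff_comp (differentiableP dc) (is_diff_dotv m (c t)).
have I0 : `]- e, e[%classic (0 : R) by rewrite /= in_itv /= oppr_lt0 e0.
have le_e : - e <= e by rewrite ge0_cp// ltW.
have dc : differentiable (c : R^o -> _) (0 : R^o) by exact: smooth_on_differentiable sc I0.
have [|//|t te|dphi0 vphi0] := derive1_at_min (f := dotv m \o c) (c := 0) le_e.
- move=> t te; apply/derivable1_diffP.
  by have [] := dphi t te.
- by rewrite /= c0; apply/mp/Sc.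
have [d v'] := dphi 0 I0.
have := congr1 (fun k => k 1) v'; rewrite -deriveE// vphi0 /= -derive1E'// c'0.
by [].
Qed.

(** On the line [s - q] is parallel to [ey], so [det2] vanishes; only [p] could be a common point,
    but it differs from [q] within the plane [y = 0]. *)
Lemma avoiding_yline {R : realType} (S : set 'rV[R]_3) (p q : 'rV[R]_3) :
  p 0 1 = 0 -> q 0 1 = 0 -> p != q ->
  (forall s, S s -> s <> p -> det2 (p - q) (s - q) < 0) ->
  lines_avoiding S (yline q).
Proof.
move=> p1 q1 pq neg; rewrite /lines_avoiding /= -subset0 yline_set.
move=> _ [[t _ <-] Sx].
have [xp|/(neg _ Sx)] := pselect (q + t *: ey = p).
  have t0 : t = 0.
    by have := congr1 (fun u : 'rV[R]_3 => u 0 1) xp; rewrite !mxE /= p1 q1; lra.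
  by move: pq; rewrite -xp t0 scale0r addr0 eqxx.
by rewrite addrAC subrr add0r /det2 [in X in X < 0]mxE !mxE /= !mulr0 subrr ltxx.
Qed.

(** Seen from [q], the projection of [S] fills an angle with one side through [p]; [p'] lies on the
    other side. It serves as the witness for the negative tangency. *)
Lemma second_tangency {R : realType} (S : set 'rV[R]_3) (p q : 'rV[R]_3) :
  closed_surface S -> strictly_convex S -> [set reflect_y z | z in S] = S ->
  S p -> p 0 1 = 0 -> q 0 1 = 0 -> p != q ->
  (forall s, S s -> s <> p -> det2 (p - q) (s - q) < 0) ->
  (exists2 s, S s & s <> p) ->
  exists p', [/\ tangency S (yline q) p' q, S p' & p' <> p].
Proof.
move=> clS cS rS Sp p1 q1 pq neg [s1 Ss1 s1p]; have [_ kS _ eS] := clS.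
set v := p - q; have v1 : v 0 1 = 0 by rewrite /v !mxE p1 q1 oppr0 addr0.
have vv : 0 < dotv v v by rewrite dotv_gt0// subr_eq0.
pose m : 'rV[R]_3 := vec3 (v 0 2) 0 (- v 0 0).
have mE w : dotv m w = - det2 v w by rewrite dotvE /m !vec3E /det2; ring.
have mv : dotv m v = 0 by rewrite mE /det2; ring.
have eta_gt0 s : S s -> s <> p -> 0 < dotv m (s - q).
  by move=> Ss sp; rewrite mE oppr_gt0; exact: neg.
pose a s := dotv v (s - q); pose eta s := dotv m (s - q).
have ca u : continuous (fun s : 'rV[R]_3 => dotv u (s - q) : R).
  move=> s; apply: (@continuous_comp _ _ _ (fun s : 'rV[R]_3 => s - q) (dotv u)).
    by apply: continuousB => //; exact: cst_continuous.
  exact: continuous_dotv.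
(* The second tangency point minimizes the cotangent [a / eta] of the angle at q
   measured from [p - q]; [K] keeps the minimization away from p, where eta = 0. *)
pose C := a s1 / eta s1.
have e1 : 0 < eta s1 by exact: eta_gt0.
pose K := S `&` [set s | dotv (v - C *: m) (s - q) <= 0].
have KE s : dotv (v - C *: m) (s - q) = a s - C * eta s.
  by rewrite dotvC linearB linearZ /= dotvC [dotv _ m]dotvC.
have Kp s : K s -> s <> p.
  move=> [_ /=] + sp; rewrite KE /a /eta sp -/v mv mulr0 subr0.
  by rewrite leNgt vv.
have kK : compact K.
  apply: compact_closedI => //.
  by apply: (closed_comp _ (@closed_le _ 0)) => s _; exact: ca.
have K1 : K s1.
  by split=> //=; rewrite KE /C divfK ?subrr// gt_eqF.
have cf : {within K, continuous (fun s => a s / eta s)}.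
  apply: continuous_in_subspaceT => s /set_mem Ks.
  have es : 0 < eta s by apply: eta_gt0; [case: Ks|exact: Kp].
  apply: (@continuousM R _ a (fun s => (eta s)^-1)); first exact: (ca v s).
  by apply: continuousV; [rewrite gt_eqF|exact: (ca m s)].
have [p' /set_mem Kp' min'] := compact_EVT_min (ex_intro _ s1 K1) kK cf.
have Sp' : S p' by case: Kp'.
have pp' := Kp _ Kp'; have e' : 0 < eta p' := eta_gt0 _ Sp' pp'.
(* [M] is normal to the plane through the line and [p']. Minimality of [lam] makes [dotv M (s - q)]
   nonnegative on [S] and zero at [p'], so this plane is tangent at [p']. *)
pose lam := a p' / eta p'; pose M := v - lam *: m.
have ME s : dotv M (s - q) = a s - lam * eta s.
  by rewrite /M dotvC linearB linearZ /= dotvC [dotv _ m]dotvC.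
have Mp' : dotv M (p' - q) = 0 by rewrite ME /lam divfK ?subrr// gt_eqF.
have Mge0 s : S s -> 0 <= dotv M (s - q).
  move=> Ss; rewrite ME; have [->|sp] := pselect (s = p).
    by rewrite /a /eta -/v mv mulr0 subr0 ltW.
  have es : 0 < eta s by exact: eta_gt0.
  rewrite subr_ge0 -ler_pdivlMr//.
  (* Outside [K] the quotient exceeds [C], its value at [s1], which is at least the minimum. *)
  have [sK|sK] := lerP (dotv (v - C *: m) (s - q)) 0.
    by apply: min'; apply/mem_set.
  apply: le_trans (min' s1 (mem_set K1)) _.
  by rewrite -/C ler_pdivlMr// -subr_ge0 -KE ltW.
have Mt w : tangent_vector S p' w -> dotv M w = 0.
  apply: tangent_at_min => s Ss.
  by have := Mge0 s Ss; rewrite -Mp' !linearB /= lerD2r.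
have M0 : M != 0.
  apply/eqP => M0; have := ME p; rewrite /a /eta -/v mv mulr0 subr0 M0 => /esym vv0.
  by move: vv; rewrite vv0 dotvE !mxE !mul0r !addr0 ltxx.
have M1 : M 0 1 = 0 by rewrite /M [LHS]mxE v1 add0r !mxE /= mulr0 oppr0.
have [nu nu0 nuE] := tangent_normal S p' eS Sp'.
have tM w : dotv M w = 0 -> tangent_vector S p' w.
  move=> Mw; apply/nuE; move: Mw; apply: orthogonal_sub => // u.
  by move/nuE/Mt.
have Mey : dotv M ey = 0 by rewrite dotvE M1 !eyE; ring.
have p'1 : p' 0 1 = 0.
  exact: tangent_ey_reflect clS cS rS Sp' (tM _ Mey).
exists p'; split=> //; split=> //.
  rewrite yline_set => _ [t _ <-]; apply: tM.
  rewrite addrAC linearD linearZ /= Mey scaler0 addr0 -opprB linearN /= Mp'.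
  by rewrite oppr0.
by apply/closest_yline; rewrite ?p'1 ?q1.
Qed.

(** The sign condition makes [p] the positive tangency whatever the other one is, and translating
    [q] by twice [p - q] gives [p + p - q]. *)
Lemma outer_billiard_yline {R : realType} (S : set 'rV[R]_3) (p q : 'rV[R]_3) :
  closed_surface S -> strictly_convex S -> [set reflect_y z | z in S] = S ->
  S p -> p 0 1 = 0 -> q 0 1 = 0 -> p != q ->
  (forall s, S s -> s <> p -> det2 (p - q) (s - q) < 0) ->
  (exists2 s, S s & s <> p) ->
  line_set (yline q) `<=` tangent_plane S p ->
  outer_billiard S (yline q) = yline (p + p - q).
Proof.
move=> clS cS rS Sp p1 q1 pq neg ex LS.
have Lq := avoiding_yline S p q p1 q1 pq neg.
have enorm_gt0 (u : 'rV[R]_3) : u != 0 -> 0 < enorm u.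
  by move=> u0; rewrite sqrtr_gt0 dotv_gt0.
have Wz (u : 'rV[R]_3) : u != 0 -> (2 * enorm u) *: ((enorm u)^-1 *: u) = u + u.
  move=> u0; rewrite scalerA mulfK; last by rewrite gt_eqF// enorm_gt0.
  by rewrite scaler_nat mulr2n.
have vp : p - q != 0 by rewrite subr_eq0.
have tp : tangency S (yline q) p q.
  by split=> //; apply/closest_yline; rewrite ?p1 ?q1.
have orientE (u w : 'rV[R]_3) : u != 0 -> w != 0 ->
    positively_oriented ((enorm u)^-1 *: u) ((enorm w)^-1 *: w) (line_dir (yline q)) <->
    det2 u w < 0.
  move=> u0 w0; rewrite /positively_oriented yline_dir det_ey det2Z oppr_gt0.
  by rewrite pmulr_rlt0// mulr_gt0// invr_gt0 enorm_gt0.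
have Snq s : S s -> s - q != 0.
  move=> Ss; apply/eqP => /subr0_eq sq.
  have : (line_set (yline q) `&` S) s.
    by split=> //; rewrite yline_set sq; exists 0; rewrite ?scale0r ?addr0.
  by rewrite Lq.
have uniq L' : outer_billiard_rel S (yline q) L' -> L' = yline (p + p - q).
  move=> [pp [qp [pm [qm [tpp tpm pos ->]]]]].
  have [qpE [sp spos]] := tangency_sign S pp q qp clS cS rS Lq q1 tpp.
  have [qmE _] := tangency_sign S pm q qm clS cS rS Lq q1 tpm.
  have [Spp _ _] := tpp; have [Spm _ _] := tpm.
  rewrite qpE qmE in pos *.
  have {}pos := (orientE _ _ (Snq _ Spp) (Snq _ Spm)).1 pos.
  rewrite Wz ?Snq// yline_translate.
  suff -> : pp = p by congr yline; rewrite addrA subrKC addrA.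
  (* If [pp] differed from [p], comparison with [p] would make [sg] positive, while the orientation
     of [pp] and [pm] would make it negative. *)
  have [//|ppp] := pselect (pp = p); exfalso.
  have pmpp : pm <> pp.
    by move=> pmpp; move: pos; rewrite pmpp /det2 mulrC subrr ltxx.
  have d1 := neg _ Spp ppp.
  have d2 := spos _ Sp (nesym ppp).
  have d3 := spos _ Spm pmpp.
  have dC : det2 (pp - q) (p - q) = - det2 (p - q) (pp - q) by rewrite /det2; ring.
  rewrite dC mulrN oppr_gt0 nmulr_llt0 // in d2.
  by move: d3; rewrite pmulr_rgt0// ltNge (ltW pos).
apply: uniq; rewrite /outer_billiard; apply: xgetPex.
have [p' [tp' Sp' pp']] := second_tangency S p q clS cS rS Sp p1 q1 pq neg ex.
exists (line_translate ((2 * enorm (p - q)) *: ((enorm (p - q))^-1 *: (p - q))) (yline q)).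
exists p, q, p', q; split=> //.
by apply/orientE; rewrite ?Snq//; exact: neg.
Qed.

(** * The graph *)

Lemma is_derive_vec3 {R : realType} (a b c : R -> R) (t a' b' c' : R) :
  is_derive t 1 a a' -> is_derive t 1 b b' -> is_derive t 1 c c' ->
  is_derive t 1 (fun s => vec3 (a s) (b s) (c s)) (vec3 a' b' c').
Proof.
move=> [da ea] [db eb] [dc ec].
have e0 : (fun s => vec3 (a s) (b s) (c s) 0 0) = a by apply/funext => s; rewrite vec3E.
have e1 : (fun s => vec3 (a s) (b s) (c s) 0 1) = b by apply/funext => s; rewrite vec3E.
have e2 : (fun s => vec3 (a s) (b s) (c s) 0 2) = c by apply/funext => s; rewrite vec3E.
have d : derivable (fun s => vec3 (a s) (b s) (c s)) t 1.
  apply/derivable_mxP => i j; rewrite ord1.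
  rewrite -e0 in da; rewrite -e1 in db; rewrite -e2 in dc.
  case: (ord3P j) => ->; [exact: da|exact: db|exact: dc].
apply: DeriveDef => //; rewrite derive_mx//; apply/rowP => j; rewrite mxE.
rewrite -e0 in ea; rewrite -e1 in eb; rewrite -e2 in ec.
by case: (ord3P j) => ->; rewrite vec3E.
Qed.

Lemma is_derive_translate {R : realType} (f : R -> R) (x : R) :
  derivable f x 1 -> is_derive (0 : R) 1 (fun t => f (x + t)) ('D_1 f x).
Proof.
move=> /derivable1_diffP df.
have df' : differentiable (f : R -> R^o) (x + (0 : R) *: (1 : R^o)).
  by rewrite scale0r addr0.
have [dl vl] := is_diff_line (f : R^o -> R^o) (x : R^o) (1 : R^o) 0 df'.
have e : (fun s : R => (f : R^o -> R^o) (x + s *: (1 : R^o))) = fun t => f (x + t).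
  by apply/funext => t; rewrite /GRing.scale /= mulr1.
rewrite e in dl vl.
apply: DeriveDef; first exact/derivable1_diffP.
rewrite deriveE// vl scale1r -deriveE//.
by rewrite scale0r addr0.
Qed.

(** The chart criterion supplies a smooth curve with the same velocity, so [c] itself need not be
    smooth. *)
Lemma tangent_vector_curve {R : realType} (S : set 'rV[R]_3) (c : R -> 'rV[R]_3)
    (v : 'rV[R]_3) :
  embedded_surface S -> (\forall t \near (0 : R), S (c t)) ->
  is_derive (0 : R) 1 c v -> tangent_vector S (c 0) v.
Proof.
move=> eS Sc [dc cv]; have Sc0 : S (c 0) by exact: nbhs_singleton Sc.
have [V [W [F [G ch]]]] := embedded_surface_chart _ _ eS Sc0.
apply/(tangent_vector_chart _ _ _ _ _ _ _ ch).
have dc' : differentiable c 0 by apply/derivable1_diffP.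
by rewrite -cv deriveE//; exact: (chart_derivative_curve _ _ _ _ _ _ c ch).
Qed.

Lemma graph_tangent {R : realType} (S : set 'rV[R]_3) (f : R -> R) (x : R) :
  embedded_surface S ->
  (forall x y : R, `]-2, 2[%classic x -> `]-1, 1[%classic y ->
    S (vec3 x y (f x + y ^+ 2))) ->
  `]-2, 2[%classic x -> derivable f x 1 ->
  tangent_vector S (vec3 x 0 (f x)) ey /\
  tangent_vector S (vec3 x 0 (f x)) (vec3 1 0 ('D_1 f x)).
Proof.
move=> eS gS; rewrite /= in_itv /= => /andP[x1 x2] df; split.
  have -> : vec3 x 0 (f x) = vec3 x 0 (f x + 0 ^+ 2) by rewrite expr0n addr0.
  apply: (tangent_vector_curve S (fun t => vec3 x t (f x + t ^+ 2))) => //.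
    have nI : \forall t \near (0 : R), `|t| < 1 by exact: nbhs0_lt.
    by apply: filterS nI => t t1; apply: gS; rewrite /= in_itv /= ?x1// -ltr_norml.
  apply: is_derive_vec3.
  by apply: is_derive_eq; rewrite !scale0r addr0 mulr0.
have -> : vec3 x 0 (f x) = vec3 (x + 0) 0 (f (x + 0)) by rewrite addr0.
apply: (tangent_vector_curve S (fun t => vec3 (x + t) 0 (f (x + t)))) => //.
  have nI : \forall t \near (0 : R), `|t| < Num.min (x + 2) (2 - x).
    by apply: nbhs0_lt; rewrite lt_min subr_gt0 x2 andbT -ltrBlDr sub0r.
  apply: filterS nI => t; rewrite lt_min !ltr_norml => /andP[/andP[t1 t2] /andP[t3 t4]].
  have -> : f (x + t) = f (x + t) + 0 ^+ 2 by rewrite expr0n addr0.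
  by apply: gS; rewrite /= in_itv /=; apply/andP; split; lra.
apply: is_derive_vec3; last exact: is_derive_translate.
by apply: is_derive_eq; rewrite add0r.
Qed.

(** * Non-differentiability *)

(** Both lines lie in the tangent plane at the graph point [p], symmetrically about it. Since [S]
    lies above that plane, [t > 0] makes [p] the positive tangency. *)
Lemma outer_billiard_graph {R : realType} (S : set 'rV[R]_3) (f : R -> R) (x t : R) :
  closed_surface S -> strictly_convex S -> [set reflect_y p | p in S] = S ->
  (forall x y : R, `]-2, 2[%classic x -> `]-1, 1[%classic y ->
    S (vec3 x y (f x + y ^+ 2))) ->
  `]-2, 2[%classic x -> derivable f x 1 -> 0 < t ->
  let q := vec3 (x + t) 0 (f x + t * 'D_1 f x) in
  lines_avoiding S (yline q) /\
  outer_billiard S (yline q) = yline (vec3 (x - t) 0 (f x - t * 'D_1 f x)).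
Proof.
move=> clS cS rS gS Ix df t0 q; have [_ _ _ eS] := clS.
pose p := vec3 x 0 (f x); pose d := 'D_1 f x.
have Sp : S p.
  have -> : p = vec3 x 0 (f x + 0 ^+ 2) by rewrite expr0n addr0.
  by apply: gS => //; rewrite /= in_itv /=; lra.
have [t1 t2] := graph_tangent S f x eS gS Ix df; rewrite -/p -/d in t1 t2.
have [nu nu0 nuE] := tangent_normal S p eS Sp.
have nu1 : nu 0 1 = 0.
  by have /nuE := t1; rewrite dotvE !eyE !mulr0 mulr1 add0r addr0.
have nu00 : nu 0 0 = - nu 0 2 * d.
  by have /nuE := t2; rewrite dotvE !vec3E nu1; lra.
pose n : 'rV[R]_3 := vec3 (- d) 0 1.
have nuZ : nu = nu 0 2 *: n.
  by apply: rv3P; rewrite [RHS]mxE vec3E ?nu1 ?nu00; ring.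
have nu2 : nu 0 2 != 0.
  by apply: contraNneq nu0 => nu2; rewrite nuZ nu2 scale0r.
have n0 : n != 0 by apply: contraNneq nu0 => n0; rewrite nuZ n0 scaler0.
have tangentE v : tangent_vector S p v <-> dotv n v = 0.
  apply: iff_trans (nuE v) _; rewrite nuZ dotvC linearZ /= dotvC; split.
    by move=> /eqP; rewrite scaler_eq0 (negbTE nu2) => /eqP.
  by move=> ->; rewrite scaler0.
(* This point is above the tangent plane at [p] by [1 / 4], the contribution of [y^2], and so
   decides the side of [S]. It is also the second point of [S] that [outer_billiard_yline]
   requires. *)
pose s1 := vec3 x (1 / 2) (f x + (1 / 2) ^+ 2).
have Ss1 : S s1 by apply: gS => //; rewrite /= in_itv /=; lra.
have s1p : s1 <> p.
  move=> /(congr1 (fun u : 'rV[R]_3 => u 0 1)); rewrite !vec3E; lra.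
have ns1 : dotv n p < dotv n s1 by rewrite !dotvE !vec3E; lra.
have above : forall s, S s -> s <> p -> dotv n p < dotv n s.
  have [//|below s Ss sp] := supporting_plane S p n clS cS Sp n0 (fun v => (tangentE v).1).
  by have := below _ Ss1 s1p; rewrite ltNge (ltW ns1).
have pq0 : (p - q) 0 0 = - t by rewrite mxE [X in _ + X]mxE !vec3E; ring.
have pq2 : (p - q) 0 2 = - (t * d).
  by rewrite mxE [X in _ + X]mxE !vec3E -/d; ring.
have pq : p != q.
  rewrite -subr_eq0; apply: contraTneq t0 => pq; move: pq0; rewrite pq mxE.
  by move=> t0; rewrite -leNgt; lra.
have neg s : S s -> s <> p -> det2 (p - q) (s - q) < 0.
  move=> Ss /(above s Ss); rewrite !dotvE !vec3E => nsp.
  have -> : det2 (p - q) (s - q) =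
      - (t * ((- d * s 0 0 + s 0 2) - (- d * x + f x))).
    rewrite /det2 pq0 pq2 mxE [(- q) 0 2]mxE [(s - q) 0 0]mxE [(- q) 0 0]mxE !vec3E.
    by rewrite -/d; ring.
  by rewrite oppr_lt0 mulr_gt0//; lra.
have p1 : p 0 1 = 0 by rewrite vec3E.
have q1 : q 0 1 = 0 by rewrite vec3E.
split; first exact: avoiding_yline p1 q1 pq neg.
rewrite (outer_billiard_yline S p q) //; last 2 first.
- by exists s1.
- rewrite yline_set => _ [r _ <-]; apply/tangentE.
  rewrite !dotvE !mxE /= -/d; ring.
congr yline; apply: rv3P; rewrite mxE [X in X + _]mxE [X in _ + X]mxE !vec3E; ring.
Qed.

Lemma chart_coord_yline {R : realType} (q : 'rV[R]_3) : q 0 1 = 0 ->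
  chart_coord 1 (yline q) = (col' 1 q, 0).
Proof.
move=> q1; rewrite /chart_coord; have [t [-> ->]] := yline_repr q.
have qt1 : (q + t *: ey) 0 1 = t by rewrite mxE q1 add0r mxE eyE mulr1.
rewrite qt1 eyE divr1 addrK invr1 scale1r; congr pair.
apply/rowP => i; rewrite !mxE.
by case: i => -[|[|//]] /= ?.
Qed.

(** On lines parallel to [ey], chart 1 is linear in the point of the plane [y = 0]; [xz_axis 0] and
    [xz_axis 2] are the images of the unit vectors along x and z. *)
Definition xz_axis {R : realType} (i : 'I_3) : 'rV[R]_2 * 'rV[R]_2 :=
  (col' 1 (delta_mx 0 i), 0).

Lemma chart_coord_vec3 {R : realType} (a b : R) :
  chart_coord 1 (yline (vec3 a 0 b)) = a *: xz_axis 0 + b *: xz_axis 2.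
Proof.
rewrite chart_coord_yline ?vec3E// /xz_axis; congr pair.
  apply/rowP => i; rewrite [LHS]mxE.
  have -> : vec3 a 0 b = a *: delta_mx 0 0 + b *: delta_mx 0 2.
    by apply: rv3P; rewrite vec3E !mxE /=; ring.
  by rewrite !mxE.
by rewrite /= !scaler0 addr0.
Qed.

Lemma chart_coord_fst {R : realType} (a b : R) :
  (chart_coord 1 (yline (vec3 a 0 b))).1 0 0 = a.
Proof. by rewrite chart_coord_yline ?vec3E// !mxE. Qed.

(** The other components of [ey] vanish. The chart indices supplied by smoothness are thereby
    forced, at the source and at the target. *)
Lemma chart_dom_yline {R : realType} (i : 'I_3) (s : bool) (q : 'rV[R]_3) :
  chart_dom i s (yline q) -> i = 1.
Proof.
rewrite /chart_dom /= yline_dir.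
by case: (ord3P i) => -> //; rewrite eyE mulr0 ltxx.
Qed.

Lemma differentiable_fst_coord {R : realType} (z : 'rV[R]_2 * 'rV[R]_2) :
  differentiable ((fun w : 'rV[R]_2 * 'rV[R]_2 => w.1 0 0) : _ -> R^o) z.
Proof.
apply: (@differentiable_comp _ _ _ _ fst (fun u : 'rV[R]_2 => u 0 0 : R^o)).
  by apply: linear_differentiable => u; exact: cvg_fst.
exact: differentiable_coord.
Qed.

(* At [x = 0] the vanishing of [f'] and [f''] makes both partial derivatives of
   [(x, t) |-> (x + t, f x + t * f' x)] equal to the same vector, while those of
   the image [(x - t, f x - t * f' x)] are opposite. *)
Lemma no_differentiable_reflection {R : realType} {V : normedModType R}
    (f f' : R -> R) (H : V -> R^o) (O : set V) (a b : V) :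
  open O -> O a -> differentiable H a -> f 0 = 0 -> f' 0 = 0 ->
  is_derive (0 : R) 1 f 0 -> is_derive (0 : R) 1 f' 0 ->
  (forall x t, -2 < x < 2 -> 0 < t ->
     let z := (x + t) *: a + (f x + t * f' x) *: b in O z -> H z = x - t) ->
  False.
Proof.
move=> oO Oa dH f0 f'0 [df ef] [df' ef'] Hz.
have a1 : 0 + (1 : R) *: a = a by rewrite scale1r add0r.
(* Fix [x = 0] and vary [t] near 1: the point is [t *: a] and [H] equals [- t]. *)
have Hm : 'd H a a = -1.
  have dH1 : differentiable H (0 + (1 : R) *: a) by rewrite a1.
  have [dl vl] := is_diff_line H 0 a 1 dH1.
  have := congr1 (fun k => k 1) vl; rewrite -deriveE// scale1r a1 => <-.
  have [_ dm] := is_deriveNid (1 : R^o) (1 : R^o); rewrite -[RHS]dm.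
  apply: near_eq_derive; near=> s.
  have zE : 0 + s *: a = (0 + s) *: a + (f 0 + s * f' 0) *: b.
    by rewrite f0 f'0 mulr0 addr0 scale0r addr0 !add0r.
  rewrite zE Hz ?sub0r//.
  - by lra.
  - by near: s; exact: lt_nbhsr.
  - rewrite -zE; near: s; apply: near_line => //; rewrite a1; exact: Oa.
(* Fix [t = 1] and vary [x] near 0: the coefficients [r1] and [r2] have derivatives 1 and 0, so the
   velocity is again [a], while [H] equals [x - 1]. *)
have Hp : 'd H a a = 1.
  pose r1 (x : R) := x + 1; pose r2 (x : R) := f x + f' x.
  have dr1 : is_derive (0 : R) 1 (r1 : R -> R^o) 1.
    by apply: is_derive_eq; rewrite addr0.
  have dr2 : is_derive (0 : R) 1 (r2 : R -> R^o) 0.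
    have df0 : is_derive (0 : R) 1 f 0 by [].
    have df'0 : is_derive (0 : R) 1 f' 0 by [].
    by apply: is_derive_eq; rewrite addr0.
  have d1 : differentiable (r1 : R -> R) 0 by apply/derivable1_diffP; case: dr1.
  have d2 : differentiable (r2 : R -> R) 0 by apply/derivable1_diffP; case: dr2.
  have c0 : r1 0 *: a + r2 0 *: b = a.
    by rewrite /r1 /r2 f0 f'0 add0r addr0 scale1r scale0r addr0.
  have dc1 := differentiableZl a d1; have dc2 := differentiableZl b d2.
  pose c := (fun x => r1 x *: a) + (fun x => r2 x *: b).
  have dc : differentiable c 0 by exact: differentiableD.
  have cE : c 0 = a by [].
  have dH0 : differentiable H (c 0) by rewrite cE.
  have cv : 'd c 0 1 = a.
    rewrite (diffD dc1 dc2) (diffZl a d1) (diffZl b d2) /= -!deriveE//.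
    have [_ ->] := dr1; have [_ ->] := dr2.
    by rewrite scale1r scale0r addr0.
  have := diff_comp dc dH0 => /(congr1 (fun k => k 1)).
  rewrite /= cv cE -deriveE; last exact: differentiable_comp.
  move=> <-.
  have dm : is_derive (0 : R) 1 (fun x : R => x - 1) 1.
    by apply: is_derive_eq; rewrite subr0.
  have [_ dmE] := dm; rewrite -[RHS]dmE.
  have nI : \forall x \near (0 : R), `|x| < 2 by exact: nbhs0_lt.
  apply: near_eq_derive; near=> x.
  have zE : c x = (x + 1) *: a + (f x + 1 * f' x) *: b by rewrite mul1r.
  rewrite /= zE Hz //.
  - rewrite -ltr_norml; near: x; exact: nI.
  - rewrite -zE; near: x.
    have cc : {for 0, continuous c} by exact: differentiable_continuous.
    by apply: (cc O); apply: open_nbhs_nbhs; split=> //; rewrite cE.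
by have := Hp; rewrite Hm; lra.
Unshelve. all: by end_near. Qed.

Theorem proposition1p3 (R : realType) (S : set 'rV[R]_3) (f : R -> R)
    (S_closed_surface : closed_surface S)
    (S_strictly_convex : strictly_convex S)
    (S_reflect : [set reflect_y p | p in S] = S)
    (f_smooth : smooth_on (`]-2, 2[%classic : set R^o) (f : R^o -> R^o))
    (graph_in_S : forall x y : R, `]-2, 2[%classic x -> `]-1, 1[%classic y ->
       S (vec3 x y (f x + y ^+ 2)))
    (f_0 : f 0 = 0) (f'_0 : f^`()%classic 0 = 0) (f''_0 : f^`(2)%classic 0 = 0) :
  ~ smooth_line_map_on (lines_avoiding S) (outer_billiard S).
Proof.
move=> smoothB.
have I0 : `]-2, 2[%classic (0 : R) by rewrite /= in_itv /=; lra.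
have df x : `]-2, 2[%classic x -> derivable f x 1.
  by move=> Ix; apply/derivable1_diffP; exact: (f_smooth [::]).
have derive1f : f^`()%classic = 'D_1 f by apply/funext => x; rewrite derive1E.
have df0 : is_derive (0 : R) 1 f 0.
  by apply: DeriveDef; [exact: df|rewrite -derive1E].
have df'0 : is_derive (0 : R) 1 ('D_1 f) 0.
  apply: DeriveDef; last by rewrite -derive1E -derive1f.
  by apply/derivable1_diffP; exact: (f_smooth [:: 1 : R^o]).
have f'0 : 'D_1 f 0 = 0 by rewrite -derive1E.
have B x t := outer_billiard_graph S f x t S_closed_surface S_strictly_convex
  S_reflect graph_in_S.
(* Smoothness is contradicted at the line with [x = 0] and [t = 1], whose chart image is
   [xz_axis 0]. *)
have [U0 _] := B 0 1 I0 (df 0 I0) ltr01.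
have [i [j [s [t [A [g [d0 oA A0 sg gB]]]]]]] := smoothB _ U0.
have i1 := chart_dom_yline _ _ _ d0; rewrite i1 in d0 A0 gB.
have axis0 : chart_coord 1 (yline (vec3 (0 + 1) 0 (f 0 + 1 * 'D_1 f 0))) = xz_axis 0.
  by rewrite chart_coord_vec3 f_0 f'0 mulr0 addr0 scale0r addr0 add0r scale1r.
rewrite axis0 in A0.
pose H z : R^o := (g z).1 0 0.
apply: (no_differentiable_reflection f ('D_1 f) H A (xz_axis 0) (xz_axis 2)) => //.
  apply: (@differentiable_comp _ _ _ _ g
    (fun w : 'rV[R]_2 * 'rV[R]_2 => w.1 0 0 : R^o)).
    exact: smooth_on_differentiable sg A0.
  exact: differentiable_fst_coord.
move=> x r /= xI r0; rewrite -chart_coord_vec3 => Az.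
have Ix : `]-2, 2[%classic x by rewrite /= in_itv.
have [_ Bq] := B x r Ix (df x Ix) r0.
have [|_ dB cB] := gB _ _ Az.
  by move: d0; rewrite /chart_dom /= !yline_dir.
rewrite Bq in dB cB; have j1 := chart_dom_yline _ _ _ dB; rewrite j1 in cB.
by rewrite /H -cB chart_coord_fst.
Qed.
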